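(* Let $k\in\mathbb{N}$ be fixed. Assume that: (i) $Z_1,\dots,Z_p$ are independent stationary Gaussian processes on $\mathbb{R}^d$ with mean zero, unit variance and covariance functions $K_1,\dots,K_p$; (ii) there is a fixed $\Delta>0$ such that for all $n\in\mathbb{N}$ and all $i\neq j$ in $\{1,\dots,n\}$, $\|s_i-s_j\|\ge\Delta$; (iii) there are fixed $A>0$ and $\alpha>0$ such that $|K_r(x)|\le A/(1+\|x\|^{d+\alpha})$ for all $x\in\mathbb{R}^d$ and $r=1,\dots,p$; (iv) $f_1,\dots,f_k:\mathbb{R}^d\to\mathbb{R}$ satisfy, for the same $A$ and $\alpha$, $|f_l(x)|\le A/(1+\|x\|^{d+\alpha})$ for all $x\in\mathbb{R}^d$ and $l=1,\dots,k$; (v) there exist a fixed $\delta>0$ and $n_0\in\mathbb{N}$ such that for all $n\ge n_0$ and every pair $i\neq j$ in $\{1,\dots,p\}$ there exists $l\in\{1,\dots,k\}$ with $|\{\Omega^{-1}M(f_l)\Omega^{-\top}\}_{i,i}-\{\Omega^{-1}M(f_l)\Omega^{-\top}\}_{j,j}|\ge\delta$. Then one can choose, for each $n$, $$\widehat\Gamma\in\operatorname*{arg\,max}_{\Gamma:\ \Gamma\widehat M(f_0)\Gamma^\top=I_p,\ \Gamma\text{ has rows }\gamma_1^\top,\dots,\gamma_p^\top}\ \sum_{l=1}^k\sum_{j=1}^p\{\gamma_j^\top\widehat M(f_l)\gamma_j\}^2$$ so that $\widehat\Gamma\to\Omega^{-1}$ in probability as $n\to\infty$.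
   Context: $d,p\ge1$ are fixed integers. For each $n\in\mathbb{N}$, $s_1,\dots,s_n\in\mathcal S^d\subseteq\mathbb{R}^d$ are the $n$ observation points. $Z=(Z_1,\dots,Z_p)^\top$ is the latent field, and $X(s)=\Omega Z(s)$ the observed field, with $\Omega$ a fixed invertible $p\times p$ matrix. $\|\cdot\|$ is the Euclidean norm, $M^{-\top}=(M^{\top})^{-1}$, $f_0(s)=I(s=0)$. For $g:\mathbb{R}^d\to\mathbb{R}$, $$\widehat M(g)=n^{-1}\sum_{i,j=1}^n g(s_i-s_j)X(s_i)X(s_j)^\top,\qquad M(g)=\mathrm{E}\{\widehat M(g)\}.$$ On the event that $\widehat M(f_0)$ is singular (where the constraint set is empty) $\widehat\Gamma$ is arbitrary. *)

(* Defs.v *)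
From HB Require Import structures.
From mathcomp Require Import all_boot all_order all_algebra.
From mathcomp Require Import all_classical all_reals all_analysis.

Set Implicit Arguments.
Unset Strict Implicit.
Unset Printing Implicit Defensive.

Import Order.TTheory GRing.Theory Num.Theory.
Import numFieldNormedType.Exports.
Local Open Scope classical_set_scope.
Local Open Scope ring_scope.

(** The library norm on ['M_(m, n)] is the sup norm; this is the Euclidean norm
    on column vectors, and the Frobenius norm on matrices. *)
Definition enorm {R : realType} {m n : nat} (A : 'M[R]_(m, n)) : R :=
  Num.sqrt (\sum_i \sum_j A i j ^+ 2).

Section Processes.
Context {dT : measure_display} {T : measurableType dT} {R : realType}.
Variable P : probability T R.

(** [normal_prob m 0] is not the point mass at [m], so the degenerate case is
    treated separately. *)
Definition gaussian_rv (X : {mfun T >-> R}) : Prop :=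
  exists m sigma : R, forall B : set R, measurable B ->
    distribution P X B =
    if sigma == 0 then dirac m B else normal_prob m sigma B.

(** All finite-dimensional distributions are (possibly degenerate) multivariate
    normal. *)
Definition gaussian_process {I : Type} (Y : I -> {mfun T >-> R}) : Prop :=
  forall (m : nat) (t : 'I_m -> I) (a : 'I_m -> R),
    gaussian_rv (\sum_(i < m) a i *: Y (t i)).

Definition stationary_covariance {V : zmodType} (Y : V -> {mfun T >-> R})
    (K : V -> R) : Prop :=
  forall x y : V, covariance P (Y x) (Y y) = (K (x - y))%:E.

Definition process_sigma_algebra {I : Type} (Y : I -> {mfun T >-> R}) :
    set (set T) :=
  <<s [set E | exists (x : I) (B : set R), measurable B /\ E = Y x @^-1` B] >>.

Definition independent_processes {I : Type} {p : nat}
    (Y : 'I_p -> I -> {mfun T >-> R}) : Prop :=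
  forall (J : {set 'I_p}) (E : 'I_p -> set T),
    (forall r, r \in J -> process_sigma_algebra (Y r) (E r)) ->
    P (\bigcap_(r in [set` J]) E r) = (\prod_(r in J) P (E r))%E.

Definition random_matrix {m n : nat} (A : T -> 'M[R]_(m, n)) : Prop :=
  forall i j, measurable_fun setT (fun w => A w i j).

Definition cvg_in_probability {m n : nat} (A : nat -> T -> 'M[R]_(m, n))
    (L : 'M[R]_(m, n)) : Prop :=
  forall eps : R, 0 < eps ->
    (fun N => P [set w | eps < enorm (A N w - L)]) @ \oo --> 0%E.

Definition expect_mx {m n : nat} (A : T -> 'M[R]_(m, n)) : 'M[R]_(m, n) :=
  \matrix_(i, j) fine 'E_P[fun w => A w i j].

End Processes.

Section BlindSourceSeparation.
Context {T : Type} {R : realType} {d p : nat}.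

Definition observed_field (Omega : 'M[R]_p) (Z : 'I_p -> 'cV[R]_d -> T -> R)
    (x : 'cV[R]_d) (w : T) : 'cV[R]_p :=
  Omega *m (\col_r Z r x w).

Definition Mhat {n : nat} (X : 'cV[R]_d -> T -> 'cV[R]_p)
    (s : 'I_n -> 'cV[R]_d) (g : 'cV[R]_d -> R) (w : T) : 'M[R]_p :=
  n%:R^-1 *: \sum_(i < n) \sum_(j < n)
    g (s i - s j) *: (X (s i) w *m (X (s j) w)^T).

Definition f0 (x : 'cV[R]_d) : R := (x == 0)%:R.

End BlindSourceSeparation.

Section JointDiagonalization.
Context {R : realType} {p k : nat}.

Definition feasible (M0 G : 'M[R]_p) : Prop := G *m M0 *m G^T = 1%:M.

Definition objective (M : 'I_k -> 'M[R]_p) (G : 'M[R]_p) : R :=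
  \sum_(l < k) \sum_(j < p) ((row j G *m M l *m (row j G)^T) 0 0) ^+ 2.

Definition argmax_set (M0 : 'M[R]_p) (M : 'I_k -> 'M[R]_p) : set 'M[R]_p :=
  [set G | feasible M0 G /\
    forall G', feasible M0 G' -> objective M G' <= objective M G].

End JointDiagonalization.

(* Main.v *)
Require Import Defs.
From HB Require Import structures.
From mathcomp Require Import all_boot all_order fingroup perm all_algebra.
From mathcomp Require Import all_classical all_reals all_analysis.
From mathcomp Require Import measurable_realfun.
From mathcomp Require Import ring lra zify.

Set Implicit Arguments.
Unset Strict Implicit.
Unset Printing Implicit Defensive.
Import Order.TTheory GRing.Theory Num.Theory.
Import numFieldNormedType.Exports.
Local Open Scope classical_set_scope.
Local Open Scope ring_scope.

(** Put [N g = Omega^-1 * Mhat g * Omega^-T]. This is the moment matrix of the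
    latent field, and by equivariance ([argmax_congr]) a matrix [G] solves the
    observed problem iff [G *m Omega] solves the problem for the matrices [N g].
    So it suffices to understand the latter near its expected value.

    Probability. The entries of [N g] are quadratic forms in Gaussian variables.
    Fourth moments are computed from Isserlis' formula ([isserlis]) inside one
    process and from independence between two processes ([latent_moment4]). The
    variance of an entry is then [n^-2] times a sum over quadruples of points of
    products of four decaying kernels. Since the points are [Delta]-separated and
    the kernels decay faster than [|x|^-d], each kernel has row sums bounded by a
    constant [C] independent of [n] ([separated_decay_sum]), and three of the
    four summations cost a constant only: the variance is at most
    [2 * C ^+ 4 / n] ([quadratic_form_variance]). By Chebyshev's inequality,
    [N f0] is close to the identity and each [N (f l)] is close to its mean with
    probability tending to one. The means are diagonal, bounded by [C ^+ 2], and
    the identifiability assumption says that their diagonals separate any two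
    indices by [delta].

    Algebra. If [N f0] is close to the identity, the squared entries
    [W j a = G j a ^+ 2] of a feasible [G] form a nearly doubly stochastic matrix.
    If moreover the [N (f l)] are close to diagonal matrices with entries
    [lam l a], the objective is close to the sum of the squares of the weighted
    means of [lam l] under the rows of [W]. It falls short of its upper bound, the
    sum of all [lam l a ^+ 2], by a sum of weighted variances. A maximizer has
    small variances, and separation forces each row of [W] to concentrate on one
    index ([row_weights_product_le], [nearly_permutation]). Hence a maximizer is
    close to a signed permutation matrix, and undoing this signed permutation
    gives another maximizer, close to the identity ([argmax_near_identity]).

    Choice. Signed permutations of the rows cannot be told apart by the problem,
    so the estimator has to be chosen among the maximizers: the one closest to
    [invmx Omega] is as close as the maximizer just described. It has to be a
    random matrix, which is a measurable selection problem ([argmax_selection]).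
    Maximizers exist because an invertible [Mhat f0] is a Gram matrix, hence
    positive definite, so that symmetric elimination gives a feasible matrix
    ([posdef_whitening_near]), and because the feasible set is compact. *)

(** * Integrable functions with a known integral *)

Section HasIntegral.
Context {d} {T : measurableType d} {R : realType}.
Variables (mu : {measure set T -> \bar R}) (D : set T).
Implicit Types (f g : T -> R) (a b c : R).

(** Integrability together with the value of the integral: a form that is
    closed under linear combinations without finiteness side conditions. *)
Definition has_integral f c :=
  [/\ measurable D, mu.-integrable D (EFin \o f) &
      (\int[mu]_(x in D) (f x)%:E = c%:E)%E].

Lemma has_integralD f g a b : has_integral f a -> has_integral g b ->
  has_integral (fun x => f x + g x) (a + b).
Proof.
move=> [mD i1 e1] [_ i2 e2]; split=> //; first exact: (integrableD mD i1 i2).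
by rewrite integralD_EFin// e1 e2.
Qed.

Lemma has_integralZ f a c : has_integral f a ->
  has_integral (fun x => c * f x) (c * a).
Proof.
move=> [mD i1 e1]; split => //; first exact: (integrableZl mD c i1).
by under eq_integral do rewrite EFinM; rewrite integralZl// e1.
Qed.

Lemma has_integralB f g a b : has_integral f a -> has_integral g b ->
  has_integral (fun x => f x - g x) (a - b).
Proof.
move=> [mD i1 e1] [_ i2 e2]; split=> //; first exact: (integrableB mD i1 i2).
by rewrite integralB_EFin// e1 e2.
Qed.

Lemma eq_has_integral f g a b : (forall x, f x = g x) -> a = b ->
  has_integral f a -> has_integral g b.
Proof. by move=> /funext -> ->. Qed.

Lemma has_integral0 : measurable D -> has_integral (fun=> 0) 0.
Proof.
move=> mD; split => //; last by rewrite integral0.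
exact: (integrable0 mu D).
Qed.

Lemma has_integral_sum (I : Type) (r : seq I) (P : pred I)
    (f : I -> T -> R) (c : I -> R) : measurable D ->
  (forall i, P i -> has_integral (f i) (c i)) ->
  has_integral (fun x => \sum_(i <- r | P i) f i x) (\sum_(i <- r | P i) c i).
Proof.
move=> mD h; elim: r => [|i r IH].
  by apply: eq_has_integral (has_integral0 mD) => [x|]; rewrite big_nil.
have [Pi|Pi] := boolP (P i).
  apply: eq_has_integral (has_integralD (h i Pi) IH) => [x|];
  by rewrite big_cons Pi.
by apply: eq_has_integral IH => [x|]; rewrite big_cons (negbTE Pi).
Qed.

Lemma has_integral_uniq f a b : has_integral f a -> has_integral f b -> a = b.
Proof. by move=> [_ _ e1] [_ _]; rewrite e1 => -[]. Qed.

Lemma ge0_has_integral f c : measurable D -> measurable_fun D f ->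
  (forall x, D x -> 0 <= f x) ->
  (\int[mu]_(x in D) (f x)%:E = c%:E)%E -> has_integral f c.
Proof.
move=> mD mf f0 fc; split => //; apply/integrableP; split.
  exact/measurable_EFinP.
under eq_integral => x do [rewrite inE => Dx; rewrite gee0_abs ?lee_fin ?f0//].
by rewrite fc ltry.
Qed.

End HasIntegral.

(** * Moments of the standard Gaussian weight *)

Section Density.
Context {d} {T : measurableType d} {R : realType}.
Variables (mu nu : {measure set T -> \bar R}) (g : T -> R).
Hypothesis mg : measurable_fun setT g.
Hypothesis g0 : forall x, 0 <= g x.
Hypothesis nug : forall A, measurable A -> nu A = (\int[mu]_(x in A) (g x)%:E)%E.

Import HBNNSimple.

(** The Radon-Nikodym change of measure for an explicit density: true for simple
    functions by linearity, then in general by monotone convergence. *)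
Lemma ge0_integral_density (f : T -> \bar R) :
  measurable_fun setT f -> (forall x, (0 <= f x)%E) ->
  (\int[nu]_x f x = \int[mu]_x (f x * (g x)%:E))%E.
Proof.
move=> mf f0.
have mg' : measurable_fun setT (EFin \o g) by exact/measurable_EFinP.
have g0' x : (0 <= (g x)%:E)%E by rewrite lee_fin.
have Hi E : measurable E ->
    (\int[nu]_x (\1_E x)%:E =
     \int[mu]_x ((\1_E x)%:E * (g x)%:E))%E.
  move=> mE; rewrite integral_indic//= setIT nug// [LHS]integral_mkcond.
  apply: eq_integral => x _; rewrite patchE indicE.
  by case: ifPn => _; rewrite ?mul1e ?mul0e.
have Hs (h : {nnsfun _ >-> R}) :
    (\int[nu]_x (h x)%:E =
     \int[mu]_x ((h x)%:E * (g x)%:E))%E.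
  under [LHS]eq_integral do rewrite fimfunE -fsumEFin//.
  rewrite [LHS]ge0_integral_fsum//; last 2 first.
    - by move=> r; exact/measurable_EFinP/measurableT_comp.
    - by move=> n x _; rewrite EFinM nnfun_muleindic_ge0.
  under [RHS]eq_integral.
    move=> x xD; rewrite fimfunE -fsumEFin// ge0_mule_fsuml; last first.
      by move=> r; rewrite EFinM nnfun_muleindic_ge0.
    over.
  rewrite [RHS]ge0_integral_fsum//; last 2 first.
    - move=> r; apply: emeasurable_funM => //.
      by apply/measurable_EFinP; apply/measurableT_comp => //; exact: measurable_indic.
    - by move=> n x _; rewrite mule_ge0// EFinM nnfun_muleindic_ge0.
  apply: eq_fsbigr => r _.
  have [r0|r0] := ltP r 0.
    have E0 : h @^-1` [set r] = set0 by exact: preimage_nnfun0.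
    rewrite E0; under eq_integral do rewrite indic0 mulr0.
    rewrite integral0.
    by under eq_integral do rewrite indic0 mulr0 mul0e; rewrite integral0.
  under eq_integral do rewrite EFinM.
  under [RHS]eq_integral do rewrite EFinM -muleA.
  have m1 : measurable_fun setT (fun x => (\1_(h @^-1` [set r]) x)%:E : \bar R).
    by apply/measurable_EFinP; exact: measurable_indic.
  rewrite (ge0_integralZl)//.
  rewrite ge0_integralZl//; first by rewrite Hi.
  - exact: emeasurable_funM.
  - by move=> x _; rewrite mule_ge0.
pose f_ := nnsfun_approx measurableT mf.
transitivity (lim (\int[nu]_x (f_ n x)%:E @[n --> \oo])%E).
  rewrite -monotone_convergence//=.
  - apply: eq_integral => ? /[!inE] xD; apply/esym/cvg_lim => //=.
    exact: cvg_nnsfun_approx.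
  - by move=> n; exact/measurable_EFinP/measurable_funTS.
  - by move=> n ? _; rewrite lee_fin.
  - by move=> ? _ ? ? mn; rewrite lee_fin; exact/lefP/nd_nnsfun_approx.
rewrite [RHS](_ : _ = lim
    (\int[mu]_x ((f_ n x)%:E * (g x)%:E) @[n --> \oo])%E).
  by apply: congr_lim; apply/funext => n /=.
rewrite -monotone_convergence//=.
- apply: eq_integral => x /[!inE] xD; apply/esym/cvg_lim => //.
  rewrite muleC; under eq_fun do rewrite muleC.
  by apply: cvgeZl => //; exact: cvg_nnsfun_approx.
- move=> n; apply: emeasurable_funM => //.
  exact/measurable_EFinP/measurable_funTS.
- by move=> n x _; rewrite mule_ge0// lee_fin.
- move=> x _ i j ij; rewrite lee_wpmul2r// lee_fin.
  exact/lefP/nd_nnsfun_approx.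
Qed.

End Density.

Section GaussMoments.
Context {R : realType}.
Notation mu := (@lebesgue_measure R).
Implicit Types x : R.

Lemma is_derive_gauss_fun x :
  is_derive x 1 (@gauss_fun R) (- (2 * x) * gauss_fun x).
Proof.
have h : is_derive x 1 (fun y : R => - y ^+ 2) (- (2 * x)).
  by apply: is_derive_eq; rewrite /GRing.scale/=; ring.
rewrite /gauss_fun -[X in is_derive _ _ X _]/(expR \o (fun y : R => - y ^+ 2)).
apply: is_derive_eq.
by rewrite mulrC.
Qed.

(** The term of degree two of the exponential series beats the cube. *)
Lemma gauss_fun_cube_le x : 0 < x -> x ^+ 3 * gauss_fun x <= 2 * x^-1.
Proof.
move=> x0; rewrite /gauss_fun expRN ler_pdivrMr ?expR_gt0//.
have := @expR_ge1Dxn R (x ^+ 2) 1 (sqr_ge0 x); rewrite (_ : 2`! = 2%N)// => h.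
have {}h : x ^+ 4 / 2 <= expR (x ^+ 2) by move: h; rewrite -exprM; lra.
apply: (@le_trans _ _ (2 / x * (x ^+ 4 / 2))); last first.
  by rewrite ler_wpM2l// mulr_ge0// invr_ge0 ltW.
by rewrite le_eqVlt; apply/orP; left; apply/eqP; field; rewrite gt_eqF.
Qed.

Lemma cvg_cube_gauss_fun : x ^+ 3 * gauss_fun x @[x --> +oo] --> (0 : R).
Proof.
apply: (@squeeze_cvgr _ _ _ _ (cst 0) (fun x : R => 2 * x^-1)).
- near=> x; rewrite gauss_fun_cube_le; last by near: x; exact: nbhs_pinfty_gt.
  by rewrite mulr_ge0// ?gauss_fun_ge0// exprn_ge0//; near: x; exact: nbhs_pinfty_ge.
- exact: cvg_cst.
- rewrite -(mulr0 2); apply: cvgM; first exact: cvg_cst.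
  apply/gtr0_cvgV0; last exact: cvg_id.
  exact: nbhs_pinfty_gt.
Unshelve. all: by end_near. Qed.

Lemma cvg_id_gauss_fun : x * gauss_fun x @[x --> +oo] --> (0 : R).
Proof.
apply: (@squeeze_cvgr _ _ _ _ (cst 0) (fun x : R => x ^+ 3 * gauss_fun x)).
- near=> x; have x1 : 1 <= x by near: x; exact: nbhs_pinfty_ge.
  apply/andP; split; first by rewrite mulr_ge0 ?gauss_fun_ge0//; lra.
  rewrite ler_wpM2r ?gauss_fun_ge0//; nra.
- exact: cvg_cst.
- exact: cvg_cube_gauss_fun.
Unshelve. all: by end_near. Qed.

(** The integrand is the derivative of [r * gauss_fun]. Its nonnegativity is what
    makes the improper integral available without an integrability proof. *)
Lemma integral_gauss_primitive (r r' : R -> R) :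
  (forall x, is_derive x 1 r (r' x)) -> continuous r' ->
  (forall x, 0 <= x -> 0 <= r' x - 2 * x * r x) ->
  r x * gauss_fun x @[x --> +oo] --> (0 : R) ->
  (\int[mu]_(x in `[0%R, +oo[) ((r' x - 2 * x * r x) * gauss_fun x)%:E
    = (- r 0)%:E)%E.
Proof.
move=> dr cr' q0 rw0.
pose F x := r x * gauss_fun x.
have dF x : is_derive x 1 F ((r' x - 2 * x * r x) * gauss_fun x).
  have := is_derive_gauss_fun x; have := dr x => h1 h2.
  rewrite /F; apply: is_derive_eq; rewrite /GRing.scale/=; ring.
have cF : continuous F.
  move=> x; apply: differentiable_continuous; apply/derivable1_diffP.
  by case: (dF x).
have cr : continuous r.
  move=> x; apply: differentiable_continuous; apply/derivable1_diffP.
  by case: (dr x).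
rewrite (@ge0_continuous_FTC2y _ _ F 0 0)//.
- by rewrite /F /gauss_fun expr0n/= oppr0 expR0 mulr1 add0e.
- by move=> x x0; rewrite mulr_ge0 ?gauss_fun_ge0 ?q0.
- apply: continuous_subspaceT => x; apply: cvgM; last exact: continuous_gauss_fun.
  apply: cvgB; first exact: cr'.
  apply: cvgM; last exact: cr.
  by apply: cvgM; [exact: cvg_cst|exact: cvg_id].
- exact: cvg_at_right_filter (cF 0).
- by move=> x _; rewrite derive1E; case: (dF x).
Qed.

Let hl := [set` `[0%R, +oo[] : set R.

(* Each of these is [r' - 2 x r] for a polynomial [r], so that it has an explicit
   Gaussian integral, and each is nonnegative on the half line. Together with
   the constant 1 they span the monomials of degree 1, 2 and 4. *)
Let q1 x : R := 2 * x.
Let q2 x : R := 2 * x ^+ 4 - 3 * x ^+ 2 + 2 * x.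
Let q3 x : R := 2 * x ^+ 4 - 5 * x ^+ 2 + 4 * x + 1.

Let q1_ge0 x : 0 <= x -> 0 <= q1 x.
Proof. by move=> x0; rewrite mulr_ge0. Qed.

Let q2_ge0 x : 0 <= x -> 0 <= q2 x.
Proof.
move=> x0; rewrite /q2 (_ : _ + _ = x * (x ^+ 3 + (x - 1) ^+ 2 * (x + 2))); last by ring.
by rewrite mulr_ge0// addr_ge0 ?exprn_ge0// mulr_ge0 ?sqr_ge0//; lra.
Qed.

Let q3_ge0 x : 0 <= x -> 0 <= q3 x.
Proof.
move=> x0; rewrite /q3; have [x1|x1] := leP x 1.
  rewrite (_ : _ + 1 = 2 * x ^+ 4 + (1 - x) * (1 + 5 * x)); last by ring.
  apply: addr_ge0; first by rewrite mulr_ge0 ?exprn_ge0.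
  by apply: mulr_ge0; lra.
rewrite (_ : _ + 1 = 2 * (x ^+ 2 - 5 / 4) ^+ 2 + (4 * x - 17 / 8)); last by field.
apply: addr_ge0; first by rewrite mulr_ge0 ?sqr_ge0.
by lra.
Qed.

Let int_q1 : (\int[mu]_(x in hl) (q1 x * gauss_fun x)%:E = 1%:E)%E.
Proof.
have := @integral_gauss_primitive (cst (-1)) (cst 0).
rewrite /= opprK => <-.
- apply: eq_integral => x _; congr (_%:E); rewrite /q1/=; ring.
- by move=> x; exact: cvg_cst.
- move=> x x0; lra.
- by rewrite -(mulr0 (-1)); apply: cvgM; [exact: cvg_cst|exact: cvg_gauss_fun].
Qed.

Let int_q2 : (\int[mu]_(x in hl) (q2 x * gauss_fun x)%:E = 1%:E)%E.
Proof.
pose r x : R :=  - x ^+ 3 - 1; pose r' x : R :=  - 3 * x ^+ 2.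
have dr x : is_derive x 1 r (r' x).
  by rewrite /r /r'; apply: is_derive_eq; rewrite /GRing.scale/=; ring.
transitivity (\int[mu]_(x in hl) ((r' x - 2 * x * r x) * gauss_fun x)%:E)%E.
  by apply: eq_integral => x _; congr (_%:E); rewrite /q2/= /r /r'; ring.
rewrite integral_gauss_primitive//.
- by congr (_%:E); rewrite /r; ring.
- move=> x; apply: cvgM; first exact: cvg_cst.
  exact: exprn_continuous.
- move=> x x0; rewrite (_ : _ - _ = q2 x) ?q2_ge0// /q2 /r /r'; ring.
- rewrite /r; under eq_fun do rewrite mulrBl mulNr mul1r.
  rewrite -[0](subr0 0) -{1}[0]oppr0.
  by apply: cvgB; [apply: cvgN; exact: cvg_cube_gauss_fun|exact: cvg_gauss_fun].
Qed.

Let int_q3 : (\int[mu]_(x in hl) (q3 x * gauss_fun x)%:E = 2%:E)%E.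
Proof.
pose r x : R :=  x - x ^+ 3 - 2; pose r' x : R :=  1 - 3 * x ^+ 2.
have dr x : is_derive x 1 r (r' x).
  by rewrite /r /r'; apply: is_derive_eq; rewrite /GRing.scale/=; ring.
transitivity (\int[mu]_(x in hl) ((r' x - 2 * x * r x) * gauss_fun x)%:E)%E.
  by apply: eq_integral => x _; congr (_%:E); rewrite /q3/= /r /r'; ring.
rewrite integral_gauss_primitive//.
- by congr (_%:E); rewrite /r; ring.
- move=> x; apply: cvgB; first exact: cvg_cst.
  by apply: cvgM; first exact: cvg_cst; exact: exprn_continuous.
- move=> x x0; rewrite (_ : _ - _ = q3 x) ?q3_ge0// /q3 /r /r'; ring.
- rewrite /r; under eq_fun do rewrite mulrBl mulrBl.
  rewrite -[0](subr0 0) -{1}[0](subr0 0) -[X in _ - X](mulr0 2).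
  apply: cvgB; first by apply: cvgB; [exact: cvg_id_gauss_fun|exact: cvg_cube_gauss_fun].
  by apply: cvgM; [exact: cvg_cst|exact: cvg_gauss_fun].
Qed.

Let hlP (q : R -> R) (c : R) : measurable_fun setT q ->
  (forall x, 0 <= x -> 0 <= q x) ->
  (\int[mu]_(x in hl) (q x * gauss_fun x)%:E = c%:E)%E ->
  has_integral mu hl (fun x => q x * gauss_fun x) c.
Proof.
move=> mq q0 qc; apply: ge0_has_integral => //; first exact: measurable_itv.
  apply: measurable_funTS; apply: measurable_funM => //.
  exact: measurable_gauss_fun.
move=> x; rewrite /hl/= in_itv/= andbT => x0.
by rewrite mulr_ge0 ?gauss_fun_ge0 ?q0.
Qed.

Let hq1 : has_integral mu hl (fun x => q1 x * gauss_fun x) 1.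
Proof. by apply: hlP q1_ge0 int_q1; apply: measurable_funM. Qed.

Let hq2 : has_integral mu hl (fun x => q2 x * gauss_fun x) 1.
Proof.
apply: hlP q2_ge0 int_q2; apply: measurable_funD.
  by apply: measurable_funB; apply: measurable_funM => //; apply: measurable_funX.
by apply: measurable_funM.
Qed.

Let hq3 : has_integral mu hl (fun x => q3 x * gauss_fun x) 2.
Proof.
apply: hlP q3_ge0 int_q3; apply: measurable_funD => //.
apply: measurable_funD.
  by apply: measurable_funB; apply: measurable_funM => //; apply: measurable_funX.
by apply: measurable_funM.
Qed.

Let hw : has_integral mu hl (@gauss_fun R) (Num.sqrt pi / 2).
Proof.
apply: ge0_has_integral; first exact: measurable_itv.
- exact: measurable_funTS measurable_gauss_fun.
- by move=> x _; exact: gauss_fun_ge0.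
- exact: integral0y_gauss.
Qed.

Lemma gauss_moment1_halfline :
  (\int[mu]_(x in hl) (x * gauss_fun x)%:E = (2^-1)%:E)%E.
Proof.
suff [] : has_integral mu hl (fun x => x * gauss_fun x) 2^-1 by [].
apply: eq_has_integral (has_integralZ 2^-1 hq1) => [x|]; last by rewrite mulr1.
by rewrite /q1; field.
Qed.

Lemma gauss_moment2_halfline :
  (\int[mu]_(x in hl) (x ^+ 2 * gauss_fun x)%:E = (Num.sqrt pi / 4)%:E)%E.
Proof.
suff [] : has_integral mu hl (fun x => x ^+ 2 * gauss_fun x) (Num.sqrt pi / 4) by [].
apply: eq_has_integral (has_integralZ 2^-1
  (has_integralD (has_integralB hq2 hq3) (has_integralD hq1 hw))) => [x|].
  by rewrite /q1 /q2 /q3; field.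
by field.
Qed.

Lemma gauss_moment4_halfline :
  (\int[mu]_(x in hl) (x ^+ 4 * gauss_fun x)%:E = (3 * Num.sqrt pi / 8)%:E)%E.
Proof.
suff [] : has_integral mu hl (fun x => x ^+ 4 * gauss_fun x) (3 * Num.sqrt pi / 8) by [].
apply: eq_has_integral (has_integralZ 4^-1 (has_integralD
  (has_integralB (has_integralZ 2 hq2) (has_integralZ 2 hq1)) (has_integralZ 3
  (has_integralD (has_integralB hq2 hq3) (has_integralD hq1 hw))))) => [x|].
  by rewrite /q1 /q2 /q3; field.
by field.
Qed.

End GaussMoments.

Section GaussLine.
Context {R : realType}.
Notation mu := (@lebesgue_measure R).
Implicit Types x : R.

Lemma continuous_pos_part : continuous (fun x : R => Num.max x 0).
Proof.
by move=> x; apply: (@continuous_max _ _ idfun (cst 0)); [exact: cvg_id|exact: cvg_cst].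
Qed.

Lemma continuous_neg_part : continuous (fun x : R => Num.max (- x) 0).
Proof.
move=> x; apply: (@continuous_max _ _ (fun x => - x) (cst 0)); last exact: cvg_cst.
by apply: cvgN; exact: cvg_id.
Qed.

Let continuousMgauss (h : R -> R) : continuous h ->
  continuous (fun x => h x * gauss_fun x).
Proof. by move=> ch x; apply: cvgM; [exact: ch|exact: continuous_gauss_fun]. Qed.

Lemma gauss_even_moment (n : nat) (c : R) :
  (\int[mu]_(x in `[0%R, +oo[) (x ^+ n.*2 * gauss_fun x)%:E = c%:E)%E ->
  (\int[mu]_x (x ^+ n.*2 * gauss_fun x)%:E = (2 * c)%:E)%E.
Proof.
move=> h; rewrite ge0_symfun_integralT.
- by rewrite EFinM -h set_itvcy.
- by move=> x; rewrite mulr_ge0 ?gauss_fun_ge0// exprn_even_ge0// odd_double.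
- by apply: continuousMgauss; exact: exprn_continuous.
- by move=> x /=; rewrite /gauss_fun sqrrN -mul2n !exprM sqrrN.
Qed.

Let integral_maxl (f : R -> R) : continuous f -> (forall x, 0 <= f x) ->
  (forall x, x <= 0 -> f x = 0) ->
  (\int[mu]_x (f x)%:E = \int[mu]_(x in `[0%R, +oo[) (f x)%:E)%E.
Proof.
move=> cf f0 fz; rewrite [RHS]integral_mkcond; apply: eq_integral => x _.
rewrite patchE; case: ifPn => //; rewrite notin_setE/= in_itv/= andbT => /negP.
by rewrite -ltNge => x0; rewrite fz// ltW.
Qed.

(** The positive and negative parts have the same integral; this is how the mean
    is reached with nonnegative integrands only. *)
Lemma gauss_pos_part :
  (\int[mu]_x (Num.max x 0 * gauss_fun x)%:E = (2^-1)%:E)%E.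
Proof.
rewrite integral_maxl; first last.
- by move=> x x0; rewrite max_r// mul0r.
- by move=> x; rewrite mulr_ge0 ?gauss_fun_ge0// le_max lexx orbT.
- exact/continuousMgauss/continuous_pos_part.
rewrite -gauss_moment1_halfline; apply: eq_integral => x.
by rewrite inE/= in_itv/= andbT => x0; rewrite max_l.
Qed.

Lemma gauss_neg_part :
  (\int[mu]_x (Num.max (- x) 0 * gauss_fun x)%:E = (2^-1)%:E)%E.
Proof.
have f0 x : 0 <= Num.max (- x) 0 * gauss_fun x.
  by rewrite mulr_ge0 ?gauss_fun_ge0// le_max lexx orbT.
transitivity (\int[mu]_(x in `]-oo, (-0)%R]) (Num.max (- x) 0 * gauss_fun x)%:E)%E.
  rewrite [RHS]integral_mkcond; apply: eq_integral => x _.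
  rewrite patchE; case: ifPn => //; rewrite notin_setE/= in_itv/= oppr0 => /negP.
  by rewrite -ltNge => x0; rewrite max_r ?mul0r// oppr_le0 ltW.
rewrite ge0_integration_by_substitutionNy//; last first.
  exact/continuous_subspaceT/continuousMgauss/continuous_neg_part.
rewrite -gauss_moment1_halfline; apply: eq_integral => x.
rewrite inE/= in_itv/= andbT => x0; rewrite opprK max_l//.
by rewrite /gauss_fun sqrrN.
Qed.

(** The affine change of variables that standardizes a normal density; its Jacobian
    cancels the factor [s] of the normalizing constant. *)
Lemma integral_normal_pdf_standardize (h : R -> R) (m s : R) : s != 0 ->
  continuous h -> (forall x, 0 <= h x) ->
  (\int[mu]_x ((h ((x - m) / Num.sqrt (s ^+ 2 *+ 2)))%:E * (normal_pdf m s x)%:E)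
   = ((Num.sqrt pi)^-1)%:E * \int[mu]_x (h x * gauss_fun x)%:E)%E.
Proof.
move=> s0 ch h0; set c := Num.sqrt _.
have c0 : 0 < c by rewrite sqrtr_gt0 pmulrn_lgt0// exprn_even_gt0.
have sp0 : 0 < Num.sqrt pi :> R by rewrite sqrtr_gt0 pi_gt0.
pose F x : R := (x - m) / c.
have dF x : is_derive x 1 F c^-1.
  by rewrite /F; apply: is_derive_eq; rewrite /GRing.scale/=; ring.
have F'E : F^`()%classic = cst c^-1.
  by apply/funext => x; rewrite derive1E; case: (dF x).
rewrite (@increasing_ge0_integration_by_substitutionT _ F (fun x => h x * gauss_fun x))//; first last.
- by move=> x; rewrite mulr_ge0 ?gauss_fun_ge0.
- exact: continuousMgauss.
- by apply/gt0_cvgMly; [rewrite invr_gt0|exact: cvg_addrr].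
- by apply/gt0_cvgMlNy; [rewrite invr_gt0|exact: cvg_addrr_Ny].
- by rewrite F'E; exact: is_cvg_cst.
- by rewrite F'E; exact: is_cvg_cst.
- by rewrite F'E => ?; exact: cvg_cst.
- by move=> x y xy; rewrite /F ltr_pM2r ?ltrD2r ?invr_gt0.
have cFF : continuous (((fun x => h x * gauss_fun x) \o F) * F^`()%classic).
  rewrite F'E => x; apply: cvgM; last exact: cvg_cst.
  apply: (@continuous_comp _ _ _ F (fun x => h x * gauss_fun x)).
    by apply/differentiable_continuous/derivable1_diffP; case: (dF x).
  exact: continuousMgauss.
rewrite -ge0_integralZl ?lee_fin ?invr_ge0 ?(ltW sp0)//=; last 2 first.
- by apply/measurable_EFinP; exact: continuous_measurable_fun.
- move=> x _; rewrite lee_fin F'E; apply: mulr_ge0; last by rewrite /= invr_ge0 ltW.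
  by rewrite /= mulr_ge0 ?gauss_fun_ge0.
apply: eq_integral => x _; rewrite F'E -!EFinM; congr (_%:E).
rewrite normal_pdfE// !fctE /= -/(F x).
have -> : normal_fun m s x = gauss_fun (F x).
  congr expR; rewrite mulNr /F exprMn exprVn; congr (- (_ * _^-1)%R).
  by rewrite /c sqr_sqrtr// pmulrn_lge0// sqr_ge0.
have -> : normal_peak s = (Num.sqrt pi)^-1 * c^-1.
  rewrite /normal_peak /c -invfM; congr (_^-1).
  rewrite -sqrtrM ?pi_ge0//; congr Num.sqrt; ring.
by ring.
Qed.

End GaussLine.

(** * Gaussian random variables and processes *)

Section GaussianRV.
Context {dT : measure_display} {T : measurableType dT} {R : realType}.
Variable P : probability T R.

Lemma has_integral_fine (f : T -> R) : P.-integrable setT (EFin \o f) ->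
  has_integral P setT f (fine 'E_P[f]).
Proof.
move=> i; split => //; rewrite expectation.unlock fineK//.
exact: integrable_fin_num.
Qed.

Lemma has_integral_expectation (f : T -> R) c :
  has_integral P setT f c -> ('E_P[f] = c%:E)%E.
Proof. by move=> [_ _ e]; rewrite expectation.unlock. Qed.

Lemma has_integral_cst c : has_integral P setT (fun=> c) c.
Proof.
split => //; first exact: finite_measure_integrable_cst.
by rewrite integral_cst// [X in (_ * X)%E](@probability_setT _ _ _ P) mule1.
Qed.

Let posB_neg (x : R) : Num.max x 0 - Num.max (- x) 0 = x.
Proof.
have [x0|x0] := leP x 0.
  by rewrite max_l ?sub0r ?opprK// oppr_ge0.
by rewrite max_r ?subr0// oppr_le0 ltW.
Qed.

Let normal_transfer (X : {mfun T >-> R}) (m s : R) (h : R -> R) (v : R) :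
  s != 0 ->
  (forall B : set R, measurable B -> distribution P X B = normal_prob m s B) ->
  continuous h -> (forall x, 0 <= h x) ->
  (\int[lebesgue_measure]_x (h x * gauss_fun x)%:E = (v * Num.sqrt pi)%:E)%E ->
  has_integral P setT
    (fun w => h ((X w - m) / Num.sqrt (s ^+ 2 *+ 2))) v.
Proof.
move=> s0 Xd ch h0 hv; set c := Num.sqrt _.
have mhF : measurable_fun setT (fun x : R => h ((x - m) / c)).
  apply: measurableT_comp; first exact: continuous_measurable_fun.
  by apply: measurable_funM => //; exact: measurable_funB.
apply: ge0_has_integral => //.
  by apply: (measurableT_comp mhF).
pose X' : T -> measurableTypeR R := X.
have mX' : measurable_fun setT X' by exact: (measurable_funPT X).
pose X'' : {mfun T >-> measurableTypeR R} :=
  HB.pack X' (isMeasurableFun.Build _ _ _ _ X' mX').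
rewrite -(@ge0_integral_distribution _ _ _ _ _ P X''
  (fun x : measurableTypeR R => (h (((x : R) - m) / c))%:E))//.
- transitivity (\int[normal_prob m s]_x (h ((x - m) / c))%:E)%E.
    by apply: eq_measure_integral => A mA _; exact: Xd.
  rewrite (@ge0_integral_density _ _ _ lebesgue_measure _ (normal_pdf m s))//.
  + rewrite integral_normal_pdf_standardize// hv -EFinM; congr (_%:E).
    by rewrite mulrC mulfK// gt_eqF// sqrtr_gt0 pi_gt0.
  + exact: measurable_normal_pdf.
  + exact: normal_pdf_ge0.
  + exact/measurable_EFinP.
  + by move=> x; rewrite lee_fin.
- exact/measurable_EFinP.
- by move=> x; rewrite lee_fin.
Qed.

(** The mean is a hypothesis on the expectation, which says nothing about
    integrability; the law gives both that and the value [m] of the mean. *)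
Lemma gaussian_rv_moments (X : {mfun T >-> R}) : gaussian_rv P X ->
  ('E_P[X] = 0)%E ->
  exists v, has_integral P setT (fun w => X w ^+ 2) v /\
            has_integral P setT (fun w => X w ^+ 4) (3 * v ^+ 2).
Proof.
move=> [m [s Xd]]; have [s0|s0] := eqVneq s 0; move: Xd;
  [rewrite s0 eqxx|rewrite (negbTE s0)].
  (* The degenerate case: the law is a point mass. *)
  rewrite expectation.unlock => Xd EX.
  have tr (h : R -> R) : continuous h -> (forall x, 0 <= h x) ->
      has_integral P setT (h \o X) (h m).
    move=> ch h0; apply: ge0_has_integral => //.
    - by apply: measurableT_comp => //; exact: continuous_measurable_fun.
    - by move=> x _; exact: h0.
    have mh : measurable_fun setT (EFin \o h).
      by apply/measurable_EFinP; exact: continuous_measurable_fun.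
    transitivity (\int[distribution P X]_x (h x)%:E)%E.
      by rewrite ge0_integral_distribution// => x; rewrite lee_fin.
    transitivity (\int[dirac m]_x (h x)%:E)%E.
      by apply: eq_measure_integral => A mA _; exact: Xd.
    by rewrite integral_dirac// diracT mul1e.
  exists (m ^+ 2).
  have m0 : m = 0.
    have h1 := tr _ continuous_pos_part (fun x => ltac:(by rewrite le_max lexx orbT)).
    have h2 := tr _ continuous_neg_part (fun x => ltac:(by rewrite le_max lexx orbT)).
    have : has_integral P setT X m.
      by apply: eq_has_integral (has_integralB h1 h2) => [x|] /=; rewrite posB_neg.
    by move=> [_ _]; rewrite EX => -[].
  split.
    apply: (tr (fun x => x ^+ 2)); first exact: exprn_continuous.
    by move=> x; exact: sqr_ge0.
  have h4 : has_integral P setT (fun w => X w ^+ 4) (m ^+ 4).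
    apply: (tr (fun x => x ^+ 4)); first exact: exprn_continuous.
    by move=> x; rewrite -[4%N]/(2 * 2)%N exprM sqr_ge0.
  by apply: eq_has_integral h4 => //; rewrite m0 !expr0n/=; ring.
move=> Xd; rewrite expectation.unlock => EX.
set c := Num.sqrt (s ^+ 2 *+ 2).
have c0 : 0 < c by rewrite sqrtr_gt0 pmulrn_lgt0// exprn_even_gt0.
have sp0 : 0 < Num.sqrt pi :> R by rewrite sqrtr_gt0 pi_gt0.
pose U w := (X w - m) / c.
have tr h v := @normal_transfer X m s h v s0 Xd.
have hm : has_integral P setT X m.
  have E2 : 2^-1 = (2^-1 / Num.sqrt pi) * Num.sqrt pi :> R by rewrite divfK// gt_eqF.
  have h1 := tr _ (2^-1 / Num.sqrt pi) continuous_pos_part (fun x => ltac:(by rewrite le_max lexx orbT))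
    ltac:(by rewrite -E2 gauss_pos_part).
  have h2 := tr _ (2^-1 / Num.sqrt pi) continuous_neg_part (fun x => ltac:(by rewrite le_max lexx orbT))
    ltac:(by rewrite -E2 gauss_neg_part).
  apply: eq_has_integral (has_integralD (has_integralZ c (has_integralB h1 h2))
    (has_integral_cst m)) => [w|]; last by rewrite subrr mulr0 add0r.
  rewrite -/c -/(U w).
  by rewrite posB_neg /U mulrC divfK ?gt_eqF// subrK.
have m0 : m = 0 by move: hm => [_ _]; rewrite EX => -[].
have h2 : has_integral P setT (fun w => U w ^+ 2) 2^-1.
  apply: (tr (fun x => x ^+ 2)); first exact: exprn_continuous.
    by move=> x; exact: sqr_ge0.
  rewrite (gauss_even_moment (n := 1) gauss_moment2_halfline).
  by congr (_%:E); field.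
have h4 : has_integral P setT (fun w => U w ^+ 4) (3 / 4).
  apply: (tr (fun x => x ^+ 4)); first exact: exprn_continuous.
    by move=> x; rewrite -[4%N]/(2 * 2)%N exprM sqr_ge0.
  rewrite (gauss_even_moment (n := 2) gauss_moment4_halfline).
  by congr (_%:E); field.
exists (c ^+ 2 * 2^-1).
have XU w : X w = c * U w by rewrite /U m0 subr0 mulrC divfK// gt_eqF.
split.
  by apply: eq_has_integral (has_integralZ (c ^+ 2) h2) => [w|//]; rewrite XU; ring.
apply: eq_has_integral (has_integralZ (c ^+ 4) h4) => [w|]; first by rewrite XU; ring.
by field.
Qed.

End GaussianRV.

Section GaussianProcess.
Context {dT : measure_display} {T : measurableType dT} {R : realType}.
Variables (P : probability T R) (I : Type) (Y : I -> {mfun T >-> R}).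
Hypothesis Y_gauss : gaussian_process P Y.
Hypothesis Y_mean : forall x, ('E_P[Y x] = 0)%E.
Variable k : I -> I -> R.
Hypothesis Y_cov : forall x y, covariance P (Y x) (Y y) = (k x y)%:E.

Let mfun_sumE (m : nat) (t : 'I_m -> I) (a : 'I_m -> R) w :
  (\sum_(i < m) a i *: Y (t i)) w = \sum_(i < m) a i * Y (t i) w.
Proof.
by elim/big_rec2 : _ => [//|i y1 y2 _ <-].
Qed.

Lemma gaussian_process_gaussian_rv x : gaussian_rv P (Y x).
Proof.
have := Y_gauss (fun _ : 'I_1 => x) (fun=> 1).
by rewrite big_ord1 scale1r.
Qed.

(** Square integrability dominates integrability, since [|Y| <= 1 + Y ^+ 2]. *)
Lemma has_integral_mean x : has_integral P setT (Y x) 0.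
Proof.
have [v [h2 _]] := gaussian_rv_moments (gaussian_process_gaussian_rv x) (Y_mean x).
have [_ i1 _] := has_integralD (has_integral_cst P 1) h2.
have i : P.-integrable setT (EFin \o Y x).
  apply: le_integrable i1 => //; first exact/measurable_EFinP.
  move=> w _; rewrite /= lee_fin [leRHS]ger0_norm ?addr_ge0 ?sqr_ge0//.
  rewrite ler_norml; apply/andP; split; nra.
by have := has_integral_fine i; rewrite Y_mean.
Qed.

Lemma has_integral_cov x y : has_integral P setT (fun w => Y x w * Y y w) (k x y).
Proof.
have [v [h2 _]] := gaussian_rv_moments (gaussian_process_gaussian_rv x) (Y_mean x).
have [u [h2' _]] := gaussian_rv_moments (gaussian_process_gaussian_rv y) (Y_mean y).
have [_ i1 _] := has_integralD h2' h2.
have i : P.-integrable setT (EFin \o (fun w => Y x w * Y y w)).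
  apply: le_integrable i1 => //.
    by apply/measurable_EFinP; exact: measurable_funM.
  move=> w _; rewrite /= lee_fin [leRHS]ger0_norm ?addr_ge0 ?sqr_ge0//.
  rewrite ler_norml; apply/andP; split; nra.
have := has_integral_fine i.
have -> : ('E_P[(fun w => Y x w * Y y w)%R] = (k x y)%:E)%E.
  rewrite -Y_cov covariance.unlock !Y_mean /=; congr expectation.
  by apply/funext => w; rewrite !fctE /= !subr0.
by [].
Qed.

Let lin4 (x y z t : I) (a b c e : R) w :=
  a * Y x w + b * Y y w + c * Y z w + e * Y t w.

Let lin4_moment (x y z t : I) (a b c e : R) :
  has_integral P setT (fun w => lin4 x y z t a b c e w ^+ 4)
   (3 * (a ^+ 2 * k x x + b ^+ 2 * k y y + c ^+ 2 * k z z + e ^+ 2 * k t t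
     + 2 * (a * b * k x y + a * c * k x z + a * e * k x t + b * c * k y z
            + b * e * k y t + c * e * k z t)) ^+ 2).
Proof.
pose tt (i : 'I_4) := tnth [tuple x; y; z; t] i.
pose aa (i : 'I_4) := tnth [tuple a; b; c; e] i.
have g := Y_gauss tt aa.
pose L : {mfun T >-> R} := (\sum_(i < 4) aa i *: Y (tt i)).
have LE w : L w = lin4 x y z t a b c e w.
  by rewrite /L mfun_sumE !big_ord_recl big_ord0 addr0 /lin4 /= !addrA.
have hL : has_integral P setT L 0.
  apply: eq_has_integral (has_integralD (has_integralD (has_integralD
    (has_integralZ a (has_integral_mean x)) (has_integralZ b (has_integral_mean y)))
    (has_integralZ c (has_integral_mean z))) (has_integralZ e (has_integral_mean t)))
    => [w|]; last by ring.
  by rewrite LE.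
have [v [h2 h4]] := gaussian_rv_moments g (has_integral_expectation hL).
have hL2 := has_integralD
  (has_integralD (has_integralD (has_integralD
    (has_integralZ (a ^+ 2) (has_integral_cov x x))
    (has_integralZ (b ^+ 2) (has_integral_cov y y)))
    (has_integralZ (c ^+ 2) (has_integral_cov z z)))
    (has_integralZ (e ^+ 2) (has_integral_cov t t)))
  (has_integralZ 2 (has_integralD (has_integralD (has_integralD (has_integralD (has_integralD
    (has_integralZ (a * b) (has_integral_cov x y))
    (has_integralZ (a * c) (has_integral_cov x z)))
    (has_integralZ (a * e) (has_integral_cov x t)))
    (has_integralZ (b * c) (has_integral_cov y z)))
    (has_integralZ (b * e) (has_integral_cov y t)))
    (has_integralZ (c * e) (has_integral_cov z t)))).
apply: eq_has_integral h4 => [w|]; first by rewrite -LE.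
congr (_ * _ ^+ 2); apply: has_integral_uniq hL2.
apply: eq_has_integral h2 => [w|//]; rewrite [in LHS](LE w) /lin4; ring.
Qed.

(** Isserlis' formula for four variables, obtained by polarization from the
    fourth moments of the eight signed sums of the variables. *)
Lemma isserlis x y z t :
  has_integral P setT (fun w => Y x w * Y y w * Y z w * Y t w)
    (k x y * k z t + k x z * k y t + k x t * k y z).
Proof.
have m b c e := lin4_moment x y z t 1 b c e.
(* The signed sum of the eight fourth powers is 8 * 24 times the product. *)
apply: eq_has_integral (has_integralZ 192^-1
  (has_integralB (has_integralD (has_integralD (has_integralD (m 1 1 1) (m 1 (-1) (-1)))
     (m (-1) 1 (-1))) (m (-1) (-1) 1))
   (has_integralD (has_integralD (has_integralD (m (-1) 1 1) (m 1 (-1) 1))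
     (m 1 1 (-1))) (m (-1) (-1) (-1))))) => [w|].
  by rewrite /lin4; field.
by field.
Qed.

End GaussianProcess.

(** * Moments of the latent field *)

Section Independence.
Context {dT : measure_display} {T : measurableType dT} {R : realType}.
Variables (P : probability T R).

(** The joint law is the product of the marginal laws, so Fubini's theorem
    computes the expectation of the product. *)
Lemma has_integralM_indep (U V : {mfun T >-> R}) (a b : R) :
  (forall A B : set R, measurable A -> measurable B ->
     P (U @^-1` A `&` V @^-1` B) = (P (U @^-1` A) * P (V @^-1` B))%E) ->
  has_integral P setT U a -> has_integral P setT V b ->
  has_integral P setT (fun w => U w * V w) (a * b).
Proof.
move=> ind [_ iU eU] [_ iV eV].
pose W w : R * R := (U w, V w).
have mW : measurable_fun setT W by exact: measurable_fun_pair.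
pose WW : {mfun T >-> (R * R)%type} := HB.pack W (isMeasurableFun.Build _ _ _ _ W mW).
have law A : measurable A ->
    (distribution P U \x distribution P V)%E A = distribution P WW A.
  by apply: product_measure_unique; exact: ind.
have mM : measurable_fun [set: R * R] (fun z : R * R => (z.1 * z.2)%:E).
  by apply/measurable_EFinP; exact: measurable_funM.
have iU' : (distribution P U).-integrable setT (EFin : R -> \bar R).
  exact: (integrable_pushforward).
have iV' : (distribution P V).-integrable setT (EFin : R -> \bar R).
  exact: (integrable_pushforward).
have cEF (F : {mfun T >-> R}) c : P.-integrable setT (EFin \o F) ->
    (\int[P]_x (F x)%:E = c%:E)%E -> (\int[distribution P F]_y y%:E = c%:E)%E.
  by move=> iF eF; rewrite integral_distribution.
have i2 : (distribution P U \x distribution P V)%E.-integrable setT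
    (fun z : R * R => (z.1 * z.2)%:E).
  apply/integrable12ltyP => //=.
  move/integrableP : (iU') => [mid U_fin]; move/integrableP : (iV') => [_ V_fin].
  have mabs : measurable_fun [set: R] (fun y : R => `|y%:E|)%E.
    exact: measurableT_comp mid.
  under eq_integral do under eq_integral do rewrite normrM EFinM.
  under eq_integral => x _.
    rewrite ge0_integralZl//; over.
  rewrite ge0_integralZr//; last exact: integral_ge0.
  by rewrite lte_mul_pinfty// ?integral_ge0// ge0_fin_numE// integral_ge0.
have eUV : (\int[distribution P WW]_z (z.1 * z.2)%:E = (a * b)%:E)%E.
  rewrite -(eq_measure_integral _ (fun A mA _ => law A mA)) -integral12_prod_meas1//.
  under eq_integral => x _.
    rewrite /fubini_F /=; under eq_integral => y _ do rewrite EFinM.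
    rewrite integralZl// (cEF V b)//; over.
  by rewrite integralZr// (cEF U a).
have iW : P.-integrable setT (EFin \o (fun w => U w * V w)).
  apply/integrableP; split.
    by apply/measurable_EFinP; exact: measurable_funM.
  rewrite -(@ge0_integral_distribution _ _ _ _ _ P WW (fun z => `|(z.1 * z.2)%:E|)%E)//.
    rewrite -(eq_measure_integral _ (fun A mA _ => law A mA)).
    by move/integrableP : i2 => [].
  exact: measurableT_comp mM.
split => //; rewrite -eUV (@integral_distribution _ _ _ _ _ P WW)//.
Qed.

End Independence.

Section LatentField.
Context {dT : measure_display} {T : measurableType dT} {R : realType}.
Variables (P : probability T R) (p : nat) (V : zmodType).
Variables (Z : 'I_p -> V -> {mfun T >-> R}) (K : 'I_p -> V -> R).
Hypothesis Z_indep : independent_processes P Z.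
Hypothesis Z_gauss : forall r, gaussian_process P (Z r).
Hypothesis Z_mean : forall r x, ('E_P[Z r x] = 0)%E.
Hypothesis Z_cov : forall r, stationary_covariance P (Z r) (K r).

Let measurable_process_sigma (r : 'I_p) x :
  measurable_fun setT (Z r x : g_sigma_algebraType
    [set E | exists (x : V) (B : set R), measurable B /\ E = Z r x @^-1` B] -> R).
Proof.
move=> _ B mB; rewrite setTI; apply: sub_sigma_algebra.
by exists x, B.
Qed.

Let indep_pair (r s : 'I_p) (E F : set T) : r != s ->
  process_sigma_algebra (Z r) E -> process_sigma_algebra (Z s) F ->
  P (E `&` F) = (P E * P F)%E.
Proof.
move=> rs hE hF.
have := Z_indep (J := [set r; s]%SET) (E := fun q => if q == r then E else F).
rewrite big_setU1 ?inE//= big_set1 eqxx eq_sym (negbTE rs) => <-.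
  congr (P _); apply/seteqP; split => w /=.
    by move=> [Ew Fw] q /=; rewrite !inE => /orP[/eqP->|/eqP ->]; rewrite ?eqxx// eq_sym (negbTE rs).
  move=> h; split; first by have := h r; rewrite /= !inE eqxx; apply.
  by have := h s; rewrite /= !inE eqxx orbT eq_sym (negbTE rs); apply.
by move=> q; rewrite !inE => /orP[/eqP->|/eqP ->]; rewrite ?eqxx// eq_sym (negbTE rs).
Qed.

Let cov r x y : has_integral P setT (fun w => Z r x w * Z r y w) (K r (x - y)).
Proof. exact: (has_integral_cov (Z_gauss r) (Z_mean r) (Z_cov r)). Qed.

Lemma latent_moment2 r s x y :
  has_integral P setT (fun w => Z r x w * Z s y w) ((r == s)%:R * K r (x - y)).
Proof.
have [<-|rs] := eqVneq r s; first by rewrite mul1r.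
rewrite mul0r -(mul0r 0); apply: has_integralM_indep.
- move=> A B mA mB; apply: (indep_pair rs); apply: sub_sigma_algebra.
    by exists x, A.
  by exists y, B.
- exact: has_integral_mean.
- exact: has_integral_mean.
Qed.

(** Isserlis' formula within one process; between two independent processes the
    pairings across them vanish, and the product splits as that of [Z r x * Z r x']
    and [Z s y * Z s y']. *)
Lemma latent_moment4 r s x y x' y' :
  has_integral P setT (fun w => (Z r x w * Z s y w) * (Z r x' w * Z s y' w))
    (K r (x - x') * K s (y - y') +
     (r == s)%:R * (K r (x - y) * K r (x' - y') + K r (x - y') * K r (y - x'))).
Proof.
have [<-|rs] := eqVneq r s.
  apply: eq_has_integral (isserlis (Z_gauss r) (Z_mean r)
    (Z_cov r) x y x' y') => [w|].
  - by rewrite !mulrA.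
  - by rewrite mul1r; ring.
rewrite mul0r addr0.
pose U : {mfun T >-> R} := Z r x * Z r x'.
pose W : {mfun T >-> R} := Z s y * Z s y'.
have h := @has_integralM_indep _ _ _ P U W (K r (x - x')) (K s (y - y')).
suff : has_integral P setT (fun w => U w * W w) (K r (x - x') * K s (y - y')).
  apply: eq_has_integral => [w|//].
  by rewrite [RHS]mulrACA.
apply: h.
- move=> A B mA mB; apply: (indep_pair rs).
    have := measurable_funM (@measurable_process_sigma r x) (@measurable_process_sigma r x').
    by move=> /(_ measurableT A mA); rewrite setTI.
  have := measurable_funM (@measurable_process_sigma s y) (@measurable_process_sigma s y').
  by move=> /(_ measurableT B mB); rewrite setTI.
- exact: cov.
- exact: cov.
Qed.

End LatentField.

(** * Variance of the latent moment matrices *)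

Lemma has_integral_chebyshev {dT} {T : measurableType dT} {R : realType}
    (P : probability T R) (f : T -> R) (v e : R) :
  measurable_fun setT f -> has_integral P setT (fun w => f w ^+ 2) v -> 0 < e ->
  (P [set w | (e <= `|f w|)%R] <= (v / e ^+ 2)%:E)%E.
Proof.
move=> mf [_ _ ev] e0.
pose X : {mfun T >-> R} := HB.pack f (isMeasurableFun.Build _ _ _ _ f mf).
have := @markov _ _ _ P X (fun x => x ^+ 2) e e0.
rewrite expectation.unlock.
have -> : (\int[P]_w (((fun x => x ^+ 2) \o (fun x => `|x|) \o X) w)%:E = v%:E)%E.
  by rewrite -ev; apply: eq_integral => w _; rewrite /= real_normK ?num_real.
move=> h; rewrite EFinM muleC lee_pdivlMl ?exprn_gt0//; apply: h.
- exact: measurable_funX.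
- by move=> r _; exact: sqr_ge0.
- by move=> x y; rewrite !nnegrE => x0 y0; rewrite ler_sqr.
Qed.

(** Three of the four indices are summed against a kernel, at a cost [C] each; the
    remaining kernel is bounded by [C], and the remaining index gives [n]. *)
Lemma sum_kernel4_le {R : realDomainType} (n : nat) (kap : 'I_n -> 'I_n -> R) (C : R) :
  (forall i j, 0 <= kap i j) -> (forall i j, kap i j = kap j i) ->
  (forall i, \sum_j kap i j <= C) ->
  \sum_(a : 'I_n * 'I_n) \sum_(b : 'I_n * 'I_n)
     kap a.1 a.2 * kap b.1 b.2 *
       (kap a.1 b.1 * kap a.2 b.2 + kap a.1 b.2 * kap a.2 b.1)
  <= 2 * C ^+ 4 * n%:R.
Proof.
move=> k0 ks kC.
have [n0|n0] := posnP n.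
  subst n; rewrite mulr0 big1// => -[[]]//.
have C0 : 0 <= C.
  by apply: le_trans (kC (Ordinal n0)); apply: sumr_ge0.
have kle i j : kap i j <= C.
  by apply: le_trans (kC i); rewrite (bigD1 j)//= lerDl sumr_ge0.
have main : \sum_(a : 'I_n * 'I_n) \sum_(b : 'I_n * 'I_n)
    kap a.1 a.2 * C * (kap a.1 b.1 * kap a.2 b.2) <= C ^+ 4 * n%:R.
  rewrite -(pair_bigA _ (fun i j => \sum_(b : 'I_n * 'I_n)
    kap i j * C * (kap i b.1 * kap j b.2)))/=.
  rewrite -[n in n%:R]card_ord mulr_natr -sumr_const; apply: ler_sum => i _.
  apply: (@le_trans _ _ (\sum_j kap i j * C * (C * C))).
    apply: ler_sum => j _; rewrite -mulr_sumr ler_wpM2l ?mulr_ge0//.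
    rewrite -(pair_bigA _ (fun i' j' => kap i i' * kap j j'))/=.
    under eq_bigr do rewrite -mulr_sumr.
    rewrite -mulr_suml; apply: ler_pM => //; exact: sumr_ge0.
  rewrite -!mulr_suml (_ : C ^+ 4 = C * C * (C * C)); last by ring.
  by rewrite ler_wpM2r ?mulr_ge0// ler_wpM2r.
have swap : \sum_(a : 'I_n * 'I_n) \sum_(b : 'I_n * 'I_n)
    kap a.1 a.2 * C * (kap a.1 b.2 * kap a.2 b.1) <= C ^+ 4 * n%:R.
  apply: le_trans main; rewrite le_eqVlt; apply/orP; left; apply/eqP.
  apply: eq_bigr => -[i j] _ /=.
  rewrite -(pair_bigA _ (fun i' j' => kap i j * C * (kap i j' * kap j i')))/=.
  rewrite -(pair_bigA _ (fun i' j' => kap i j * C * (kap i i' * kap j j')))/=.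
  by rewrite exchange_big.
rewrite -mulrA [leRHS]mulr_natl mulr2n.
apply: le_trans (lerD main swap).
rewrite -big_split/=; apply: ler_sum => a _; rewrite -big_split/=.
apply: ler_sum => b _; rewrite -mulrDr ler_wpM2r//.
  by rewrite addr_ge0 ?mulr_ge0.
by rewrite ler_wpM2l.
Qed.

Section Variance.
Context {dT : measure_display} {T : measurableType dT} {R : realType}.
Variables (P : probability T R) (p : nat) (V : zmodType).
Variables (Z : 'I_p -> V -> {mfun T >-> R}) (K : 'I_p -> V -> R).
Hypothesis Z_indep : independent_processes P Z.
Hypothesis Z_gauss : forall r, gaussian_process P (Z r).
Hypothesis Z_mean : forall r x, ('E_P[Z r x] = 0)%E.
Hypothesis Z_cov : forall r, stationary_covariance P (Z r) (K r).
Variables (n : nat) (s : 'I_n -> V).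
Variables (g kap : 'I_n -> 'I_n -> R) (C : R).
Hypothesis kap_sym : forall i j, kap i j = kap j i.
Hypothesis kap_sum : forall i, \sum_j kap i j <= C.
Hypothesis K_kap : forall r i j, `|K r (s i - s j)| <= kap i j.
Hypothesis g_kap : forall i j, `|g i j| <= kap i j.

(** The covariances of the products of two values of the field are sums of products
    of two covariances, so that each term of the variance has four kernels. *)
Lemma quadratic_form_variance (r q : 'I_p) : exists2 v,
  has_integral P setT (fun w => (n%:R^-1 * (\sum_i \sum_j g i j * (Z r (s i) w * Z q (s j) w))
    - n%:R^-1 * (\sum_i \sum_j g i j * ((r == q)%:R * K r (s i - s j)))) ^+ 2) v
  & v <= 2 * C ^+ 4 / n%:R.
Proof.
have kap0 i j : 0 <= kap i j by apply: le_trans (g_kap i j).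
pose U (a : 'I_n * 'I_n) w := Z r (s a.1) w * Z q (s a.2) w.
pose m (a : 'I_n * 'I_n) := (r == q)%:R * K r (s a.1 - s a.2).
pose cv (a b : 'I_n * 'I_n) := K r (s a.1 - s b.1) * K q (s a.2 - s b.2)
   + (r == q)%:R * (K r (s a.1 - s b.2) * K r (s a.2 - s b.1)).
have h2 a : has_integral P setT (U a) (m a) by exact: latent_moment2.
have h4 a b : has_integral P setT (fun w => (U a w - m a) * (U b w - m b)) (cv a b).
  have h := latent_moment4 Z_indep Z_gauss Z_mean Z_cov r q (s a.1) (s a.2) (s b.1) (s b.2).
  apply: eq_has_integral (has_integralD (has_integralB h (has_integralD
    (has_integralZ (m a) (h2 b)) (has_integralZ (m b) (h2 a))))
    (has_integral_cst P (m a * m b))) => [w|].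
    by rewrite /U /=; ring.
  rewrite /cv /m; case: (r == q); rewrite /= ?mulr1n ?mulr0n; ring.
exists (n%:R^-1 ^+ 2 * \sum_a \sum_b g a.1 a.2 * g b.1 b.2 * cv a b).
  have := has_integralZ (n%:R^-1 ^+ 2) (has_integral_sum (index_enum _)
    (P := fun=> true) measurableT (fun a _ => has_integral_sum (index_enum _)
      (P := fun=> true) measurableT (fun b _ => has_integralZ (g a.1 a.2 * g b.1 b.2) (h4 a b)))).
  apply: eq_has_integral => // w.
  rewrite (pair_bigA _ (fun i j => g i j * (Z r (s i) w * Z q (s j) w)))/=.
  rewrite (pair_bigA _ (fun i j => g i j * ((r == q)%:R * K r (s i - s j))))/=.
  rewrite -mulrBr exprMn; congr (_ * _).
  rewrite -sumrB expr2 mulr_suml; apply: eq_bigr => a _.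
  rewrite mulr_sumr; apply: eq_bigr => b _.
  by rewrite /U /m; ring.
have n1 : 2 * C ^+ 4 / n%:R = n%:R^-1 ^+ 2 * (2 * C ^+ 4 * n%:R).
  have [->|n0] := eqVneq n 0%N; first by rewrite !mulr0 invr0 mulr0.
  by field; rewrite pnatr_eq0.
rewrite n1 ler_wpM2l ?sqr_ge0//.
apply: le_trans (sum_kernel4_le kap0 kap_sym kap_sum).
apply: ler_sum => a _; apply: ler_sum => b _.
apply: le_trans (ler_norm _) _; rewrite !normrM.
apply: ler_pM; [by rewrite mulr_ge0|by []|exact: ler_pM|].
rewrite /cv; apply: le_trans (ler_normD _ _) _; rewrite !normrM.
apply: lerD; first exact: ler_pM.
apply: (@le_trans _ _ (1 * (kap a.1 b.2 * kap a.2 b.1))); last by rewrite mul1r.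
apply: ler_pM; [by []|by rewrite mulr_ge0| |exact: ler_pM].
by case: (r == q); rewrite /= ?normr1 ?normr0.
Qed.

End Variance.

(** * Euclidean norm *)

Section EuclideanNorm.
Context {R : realType}.

Lemma enorm_ge0 m n (A : 'M[R]_(m, n)) : 0 <= enorm A.
Proof. exact: sqrtr_ge0. Qed.

Lemma ler_entry_enorm m n (A : 'M[R]_(m, n)) i j : `|A i j| <= enorm A.
Proof.
rewrite -sqrtr_sqr ler_wsqrtr// (bigD1 i)//= (bigD1 j)//= -addrA lerDl.
by rewrite addr_ge0 ?sumr_ge0// => *; rewrite ?sumr_ge0// => *; exact: sqr_ge0.
Qed.

Lemma enorm_le_sum m n (A : 'M[R]_(m, n)) :
  enorm A <= \sum_i \sum_j `|A i j|.
Proof.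
have s0 : 0 <= \sum_i \sum_j `|A i j|.
  by apply: sumr_ge0 => i _; apply: sumr_ge0.
rewrite -[leRHS]ger0_norm// -sqrtr_sqr ler_wsqrtr// expr2 mulr_suml.
apply: ler_sum => i _; apply: (@le_trans _ _ ((\sum_j `|A i j|) ^+ 2)).
  rewrite expr2 mulr_suml; apply: ler_sum => j _.
  rewrite -(real_normK (num_real _)) expr2 ler_wpM2l//.
  by rewrite (bigD1 j)//= lerDl sumr_ge0.
rewrite expr2 ler_wpM2l ?sumr_ge0// [leRHS](bigD1 i)//= lerDl.
by apply: sumr_ge0 => ? _; apply: sumr_ge0.
Qed.

Lemma enormN m n (A : 'M[R]_(m, n)) : enorm (- A) = enorm A.
Proof.
by congr Num.sqrt; apply: eq_bigr => i _; apply: eq_bigr => j _; rewrite mxE sqrrN.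
Qed.

Lemma measurable_enorm {dT : measure_display} {T : measurableType dT} m n
    (A : T -> 'M[R]_(m, n)) (L : 'M[R]_(m, n)) : random_matrix A ->
  measurable_fun setT (fun w => enorm (A w - L)).
Proof.
move=> mA; rewrite /enorm.
have msqrt : measurable_fun setT (@Num.sqrt R).
  by apply: continuous_measurable_fun; exact: sqrt_continuous.
apply: (measurableT_comp msqrt).
apply: measurable_sum => i; apply: measurable_sum => j.
apply: measurable_funX; under eq_fun do rewrite !mxE.
by apply: measurable_funB => //; exact: mA.
Qed.

End EuclideanNorm.

(** * Decay sums over separated points *)

Section Packing.
Context {R : realType}.

(** Condensation: the terms of indices [2k] and [2k+1] are at most [2^-t] times the
    term of index [k], so that the sum of [2m+1] terms is at most [1 + q * S] with
    [q = 2^(1-t)] and [S] the sum of [m] terms. Since [q < 1], the bound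
    [(1 - q)^-1] is inherited by longer sums. *)
Lemma bounded_riemann_sum (t : R) : 1 < t ->
  exists2 W : R, 0 <= W & forall m : nat, \sum_(k < m) (k.+1%:R `^ t)^-1 <= W.
Proof.
move=> t1.
pose a (k : nat) : R := (k.+1%:R `^ t)^-1.
pose q : R := 2 * (2 `^ t)^-1.
have p2 : 2 < 2 `^ t :> R.
  rewrite -[t](subrK 1) powRD ?pnatr_eq0 ?implybT// powRr1// ltr_pMl//.
  have := @gt0_ltr_powR R (t - 1) _ 1 2; rewrite powR1; apply.
  - by rewrite subr_gt0.
  - by rewrite nnegrE.
  - by rewrite nnegrE.
  - by rewrite ltr1n.
have q0 : 0 <= q by rewrite mulr_ge0// invr_ge0 powR_ge0.
have q1 : q < 1 by rewrite /q ltr_pdivrMr ?mul1r// powR_gt0.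
have a0 k : 0 <= a k by rewrite invr_ge0 powR_ge0.
have adec k l : (k <= l)%N -> a l <= a k.
  move=> kl; rewrite /a lef_pV2 ?posrE ?powR_gt0//.
  by apply: ge0_ler_powR; rewrite ?nnegrE ?ler_nat ?ltnS//; lra.
have step m : \sum_(k < m.*2.+1) a k <= 1 + q * \sum_(k < m) a k.
  elim: m => [|m IH].
    by rewrite big_ord_recr !big_ord0 /= add0r mulr0 addr0 /a powR1 invr1.
  rewrite doubleS 2!big_ord_recr/= [X in _ <= _ + _ * X]big_ord_recr/= mulrDr addrA.
  rewrite -addrA lerD//.
  apply: (@le_trans _ _ (a m.*2.+1 + a m.*2.+1)).
    by rewrite lerD2l adec.
  (* [m.*2.+2] is twice [m.+1]. *)
  have -> : a m.*2.+1 = (2 `^ t)^-1 * a m.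
    rewrite /a -doubleS -mul2n natrM powRM// invfM//.
  by rewrite /q; lra.
exists (1 - q)^-1; first by rewrite invr_ge0 subr_ge0 ltW.
move=> m; elim/ltn_ind: m => m IH.
have [->|m0] := posnP m.
  by rewrite big_ord0 invr_ge0 subr_ge0 ltW.
apply: (@le_trans _ _ (\sum_(k < m./2.*2.+1) a k)).
  have mle : (m <= m./2.*2.+1)%N by rewrite -[leqLHS]odd_double_half; case: odd.
  rewrite -(subnKC mle) big_split_ord/= lerDl sumr_ge0//.
apply: le_trans (step _) _.
apply: (@le_trans _ _ (1 + q * (1 - q)^-1)).
  rewrite lerD2l ler_wpM2l// IH//.
  lia.
rewrite le_eqVlt; apply/orP; left; apply/eqP; field; lra.
Qed.

(** The usual bijection between integers and naturals; it at most doubles absolute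
    values, and so preserves the decay rate of the weights. *)
Definition int_code (z : int) : nat :=
  if z is Negz k then k.*2.+1 else (`|z|%N).*2.

Lemma int_code_inj : injective int_code.
Proof. move=> [m|m] [n|n] /=; rewrite /int_code /=; lia. Qed.

Lemma int_code_le z : (int_code z <= `|z|%N.*2)%N.
Proof. case: z => m; rewrite /int_code; lia. Qed.

Lemma ler_sum_inj (I J : finType) (phi : I -> J) (F : J -> R) :
  injective phi -> (forall j, 0 <= F j) ->
  \sum_i F (phi i) <= \sum_j F j.
Proof.
move=> inj F0.
rewrite -(big_imset (h := phi) (A := predT) F) => [|x y _ _]; last exact: inj.
by rewrite [leRHS](bigID (mem (phi @: predT)))/= lerDl sumr_ge0.
Qed.

(** The power [W ^+ d] expands into the sum of the products over all index vectors
    below a common bound, and the vectors [phi i] are distinct ones of these. *)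
Lemma sum_prod_inj_le (d : nat) (a : nat -> R) (W : R) (n : nat)
    (phi : 'I_n -> 'I_d -> nat) :
  (forall k, 0 <= a k) -> (forall m : nat, \sum_(k < m) a k <= W) ->
  (forall i j, phi i =1 phi j -> i = j) ->
  \sum_i \prod_c a (phi i c) <= W ^+ d.
Proof.
move=> a0 aW inj.
pose M := (\max_i \max_c phi i c).+1.
have phiM i c : (phi i c < M)%N.
  by rewrite ltnS (leq_trans (leq_bigmax c))// (leq_bigmax (F := fun i => \max_c phi i c) i).
pose psi i : {ffun 'I_d -> 'I_M} := [ffun c => Ordinal (phiM i c)].
have ipsi : injective psi.
  move=> i j /ffunP h; apply: inj => c.
  by have := congr1 val (h c); rewrite !ffunE.
apply: (@le_trans _ _ (\sum_(f : {ffun 'I_d -> 'I_M}) \prod_c a (f c))).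
  rewrite [leLHS](eq_bigr (fun i => \prod_c a (psi i c))); last first.
    by move=> i _; apply: eq_bigr => c _; rewrite ffunE.
  apply: (ler_sum_inj (F := fun f : {ffun 'I_d -> 'I_M} => \prod_c a (f c))) => // f.
  exact: prodr_ge0.
rewrite -(bigA_distr_bigA (fun (_ : 'I_d) (k : 'I_M) => a k)).
rewrite -[d in leRHS]card_ord -prodr_const.
by apply: ler_prod => c _; rewrite sumr_ge0// aW.
Qed.

Lemma powR_1D_le (e t : R) : 0 <= e -> 0 <= t -> (1 + e) `^ t <= 2 `^ t * (1 + e `^ t).
Proof.
move=> e0 t0; have [e1|e1] := leP e 1.
  apply: (@le_trans _ _ (2 `^ t)).
    by apply: ge0_ler_powR; rewrite ?nnegrE//; lra.
  by rewrite ler_peMr ?powR_ge0// lerDl powR_ge0.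
apply: (@le_trans _ _ ((2 * e) `^ t)).
  by apply: ge0_ler_powR; rewrite ?nnegrE//; lra.
by rewrite powRM// ler_wpM2l ?powR_ge0// lerDr.
Qed.

(** A cell of the grid of mesh [Delta / d] contains at most one point of a
    [Delta]-separated family, so the points are indexed injectively by integer
    vectors; the decay in the norm is dominated by a product of one-dimensional
    summable weights of the coordinates of the cell. *)
Lemma separated_decay_sum (d : nat) (Delta A alpha : R) : (0 < d)%N ->
  0 < Delta -> 0 < A -> 0 < alpha ->
  exists C : R, forall (n : nat) (s : 'I_n -> 'cV[R]_d),
    (forall i j, i != j -> Delta <= enorm (s i - s j)) ->
    forall i, \sum_j A / (1 + enorm (s i - s j) `^ (d%:R + alpha)) <= C.
Proof.
move=> d0 D0 A0 al0.
(* The decay exponent is split evenly among the [d] coordinates. *)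
pose t : R := d%:R + alpha; pose b : R := 1 + alpha / d%:R.
have dR0 : 0 < d%:R :> R by rewrite ltr0n.
have b1 : 1 < b by rewrite ltrDl divr_gt0.
have tE : t = b * d%:R by rewrite /t /b mulrDl mul1r divfK// gt_eqF.
have t0 : 0 <= t by rewrite addr_ge0// ltW.
pose h := Delta / d%:R.
have h0 : 0 < h by rewrite divr_gt0.
have [W W0 HW] := bounded_riemann_sum b1.
pose a (k : nat) : R := (k.+1%:R `^ b)^-1.
have a0 k : 0 <= a k by rewrite invr_ge0 powR_ge0.
pose M : R := 2 * (2 + h^-1).
have M0 : 0 <= M by rewrite mulr_ge0// addr_ge0// invr_ge0 ltW.
pose C1 := A * ((2 * M) `^ t).
have C10 : 0 <= C1 by rewrite mulr_ge0 ?powR_ge0 ?ltW.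
exists (C1 * W ^+ d) => n s sep i.
pose z j c : int := Num.floor ((s i - s j) c 0 / h).
pose phi j c := int_code (z j c).
have phi_inj j j' : phi j =1 phi j' -> j = j'.
  move=> E; have [//|jj'] := eqVneq j j'; exfalso.
  have := sep _ _ jj'; rewrite leNgt => /negP; apply.
  have lth c : ((s j - s j') c 0) ^+ 2 < h ^+ 2.
    have Ez : z j c = z j' c by apply: int_code_inj; exact: E.
    have := floor_itv ((s i - s j) c 0 / h); have := floor_itv ((s i - s j') c 0 / h).
    rewrite -/(z j c) -/(z j' c) Ez intrD.
    rewrite !ler_pdivlMr// !ltr_pdivrMr// !mxE => /andP[u1 u2] /andP[v1 v2].
    suff xh : `|s j c 0 - s j' c 0| < h.
      by rewrite -[ltLHS]real_normK ?num_real// ltr_pXn2r// nnegrE ltW.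
    by rewrite ltr_norml; apply/andP; split; lra.
  rewrite -[ltRHS]ger0_norm ?(ltW D0)// -sqrtr_sqr ltr_sqrt ?exprn_gt0//.
  rewrite (eq_bigr (fun c => ((s j - s j') c 0) ^+ 2)); last first.
    by move=> c _; rewrite big_ord1.
  apply: (@lt_le_trans _ _ (\sum_(c < d) h ^+ 2)).
    apply: ltr_sum; last by move=> c _; exact: lth.
    by apply/hasP; exists (Ordinal d0); rewrite ?mem_index_enum.
  rewrite sumr_const card_ord -[leLHS]mulr_natr /h expr_div_n -mulrA ler_piMr ?sqr_ge0//.
  rewrite expr2 invfM -mulrA mulVf ?gt_eqF// mulr1 invf_le1//.
  by rewrite ler1n.
apply: (@le_trans _ _ (\sum_j C1 * \prod_c a (phi j c))); last first.
  by rewrite -mulr_sumr ler_wpM2l// sum_prod_inj_le.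
apply: ler_sum => j _; set e := enorm _.
have e0 : 0 <= e by exact: enorm_ge0.
rewrite /C1 -mulrA ler_wpM2l ?(ltW A0)//.
have et0 : 0 < 1 + e `^ t by rewrite ltr_pwDl// powR_ge0.
(* The cell index is at most [e / h + 1] in absolute value, and [int_code] at most
   doubles it: this is where the constant [M] comes from. *)
have phib c : (phi j c).+1%:R <= M * (1 + e).
  have zle : (`|z j c|%N)%:R <= e / h + 1 :> R.
    have ye : `|(s i - s j) c 0| <= e by exact: ler_entry_enorm.
    have := floor_itv ((s i - s j) c 0 / h); rewrite -/(z j c) intrD => /andP[u1 u2].
    have -> : (`|z j c|%N)%:R = `|(z j c)%:~R| :> R by rewrite natr_absz intr_norm.
    have : `|(s i - s j) c 0 / h| <= e / h.
      by rewrite normrM [`|h^-1|]ger0_norm ?invr_ge0 ?(ltW h0)// ler_wpM2r// invr_ge0 ltW.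
    rewrite !ler_norml => /andP[v1 v2]; apply/andP; split; lra.
  apply: (@le_trans _ _ (2 * (`|z j c|%N)%:R + 1)).
    rewrite -natr1 lerD2r -natrM ler_nat mul2n; exact: int_code_le.
  have hV : 0 < h^-1 by rewrite invr_gt0.
  rewrite /M; nra.
have prodle : \prod_c ((phi j c).+1%:R `^ b) <= (2 * M) `^ t * (1 + e `^ t).
  apply: (@le_trans _ _ (\prod_(c < d) ((M * (1 + e)) `^ b))).
    apply: ler_prod => c _; rewrite powR_ge0/=.
    apply: ge0_ler_powR; [lra|by rewrite nnegrE|by rewrite nnegrE mulr_ge0 ?addr_ge0|exact: phib].
  rewrite prodr_const card_ord -powR_mulrn ?powR_ge0// -powRrM -tE.
  rewrite [2 * M]mulrC powRM ?(addr_ge0 ler01 e0)// [(M * 2) `^ t]powRM// -mulrA ler_wpM2l ?powR_ge0//.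
  exact: powR_1D_le.
have Q0 : 0 < \prod_c ((phi j c).+1%:R `^ b).
  by rewrite prodr_gt0// => c _; rewrite powR_gt0.
by rewrite /a prodfV ler_pdivlMr// mulrC ler_pdivrMr.
Qed.

End Packing.

(** * Measurable selection of minimizers *)

Section MeasurableSelection.
Context {dT : measure_display} {T : measurableType dT} {R : realType} {N : nat}.
Implicit Types (C : T -> set 'rV[R]_N) (h phi : T -> 'rV[R]_N -> R).

Definition caratheodory h :=
  (forall v, measurable_fun setT (h ^~ v)) /\ (forall w, continuous (h w)).

(** Measurability of a set-valued map. Testing against sublevel sets that vary with
    [w], and not only against fixed closed sets, makes the notion stable under
    constraints and under minimization of objectives that depend on [w]. *)
Definition measurable_corr C := forall h, caratheodory h ->
  measurable [set w | exists2 v, C w v & h w v <= 0].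

Lemma caratheodory_max h phi : caratheodory h -> caratheodory phi ->
  caratheodory (fun w v => Num.max (h w v) (phi w v)).
Proof.
move=> [mh ch] [mphi cphi]; split=> [v|w v].
  by apply: (measurable_maxr (f := h ^~ v) (g := phi ^~ v)).
by apply: continuous_max; [exact: ch|exact: cphi].
Qed.

Lemma caratheodoryB_cst h (c : R) : caratheodory h ->
  caratheodory (fun w v => h w v - c).
Proof.
move=> [mh ch]; split=> [v|w v]; first exact: measurable_funB.
by apply: cvgB; [exact: nbhs_filter|exact: ch|apply: cvg_cst; exact: nbhs_filter].
Qed.

Lemma closed_le0 (f : 'rV[R]_N -> R) : continuous f -> closed [set v | f v <= 0].
Proof.
move=> cf; rewrite -[X in closed X]/(f @^-1` [set x | x <= 0]).
by apply: preimage_closed; [move=> x _; exact: cf|exact: closed_le].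
Qed.

Lemma compact_le0 C h w : compact (C w) -> continuous (h w) ->
  compact [set v | C w v /\ h w v <= 0].
Proof. by move=> cC ch; exact: compact_closedI cC (closed_le0 ch). Qed.

Lemma compact_min (A : set 'rV[R]_N) (f : 'rV[R]_N -> R) :
  A !=set0 -> compact A -> continuous f ->
  exists2 v, A v & forall u, A u -> f v <= f u.
Proof.
move=> A0 cA cf.
have [c cA' cmin] := compact_EVT_min A0 cA (continuous_subspaceT cf).
exists c; first by rewrite inE in cA'.
by move=> u Au; apply: cmin; rewrite inE.
Qed.

Definition box (m : nat) : set 'rV[R]_N := [set v | forall i, `|v 0 i| <= m%:R].

Let compact_box m : compact (box m).
Proof.
rewrite (_ : box m = [set v | forall i, `[(- m%:R), m%:R]%classic (v ord0 i)]).
  by apply: (@rV_compact R N (fun=> `[(- m%:R : R), m%:R]%classic)) => _; exact: segment_compact.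
by apply/seteqP; split => v /= h i; have := h i; rewrite /= in_itv/= ler_norml.
Qed.

Let clamp (m : nat) (x : R) := Num.max (- m%:R) (Num.min m%:R x).

Let clamp_box m x : `|clamp m x| <= m%:R.
Proof.
have m0 : 0 <= m%:R :> R by [].
rewrite ler_norml /clamp le_max lexx/= ge_max ge_min lexx andbT.
by apply: le_trans m0; rewrite oppr_le0.
Qed.

Let clamp_near m x y : `|y| <= m%:R -> `|y - clamp m x| <= `|y - x|.
Proof.
rewrite ler_norml /clamp => /andP[y1 y2]; have [mx|mx] := leP m%:R x.
  rewrite max_r; last by rewrite (le_trans y1).
  by rewrite ler0_norm ?subr_le0// ler_normr; apply/orP; right; lra.
have [//|mx'] := leP (- m%:R) x.
have -> : `|y - - m%:R| = y + m%:R by rewrite opprK ger0_norm//; lra.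
by rewrite ler_normr; apply/orP; left; lra.
Qed.

Let rat_near_box m (v : 'rV[R]_N) (e : R) : box m v -> 0 < e ->
  exists q : 'rV[rat]_N, ball v e (map_mx (fun x => clamp m (ratr x)) q).
Proof.
move=> bv e0.
have ex i : exists q : rat, `|v 0 i - ratr q| < e.
  have [q] : exists q, ratr q \in `](v 0 i - e), (v 0 i + e)[ by apply: rat_in_itvoo; lra.
  by rewrite in_itv/= => /andP[h1 h2]; exists q; rewrite ltr_norml; apply/andP; split; lra.
pose q i := xchoose (ex i).
exists (\row_i q i); split => // i j; rewrite !mxE ord1.
rewrite /ball/= ; apply: le_lt_trans (clamp_near _ (bv j)) _.
exact: xchooseP (ex j).
Qed.

Lemma measurable_lt_cst (f : T -> R) c : measurable_fun setT f ->
  measurable [set w | f w < c].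
Proof.
move=> mf; rewrite (_ : [set w | _] = f @^-1` `]-oo, c[%classic).
  by rewrite -[X in measurable X]setTI; apply: mf => //; exact: measurable_itv.
by apply/seteqP; split => w /=; rewrite in_itv.
Qed.

(** By compactness, a continuous function is nonpositive somewhere on the box iff
    it is below every [1 / (j + 1)] at some point of a countable dense subset; the
    clamped rational points are such a subset. *)
Lemma measurable_corr_box m : measurable_corr (fun=> box m).
Proof.
move=> h [mh ch].
rewrite (_ : [set w | _] = \bigcap_(j : nat) \bigcup_(q : 'rV[rat]_N)
    [set w | h w (map_mx (fun x => clamp m (ratr x)) q) < j.+1%:R^-1]).
  apply: bigcapT_measurable => j; apply: countable_bigcupT_measurable => //.
  by move=> q; apply: measurable_lt_cst; exact: mh.
apply/seteqP; split => w /=.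
  move=> [v bv hv] j _.
  have : \forall u \near v, h w u < j.+1%:R^-1.
    have := ch w v; move/cvgr_lt; apply; apply: le_lt_trans hv _.
    by rewrite invr_gt0.
  move=> /nbhs_ballP[e /= e0 he].
  have [q qe] := rat_near_box bv e0.
  by exists q => //; exact: he.
move=> H; have [v bv vmin] : exists2 v, box m v & forall u, box m u -> h w v <= h w u.
  apply: compact_min; [|exact: compact_box|exact: ch].
  by exists 0 => i; rewrite mxE normr0.
exists v => //; rewrite leNgt; apply/negP => hv0.
have [j hj] : exists j : nat, j.+1%:R^-1 < h w v.
  have [j] := ltr_add_invr hv0; rewrite add0r => hj; by exists j.
have [q _ /= hq] := H j I.
have := vmin (map_mx (fun x => clamp m (ratr x)) q).
rewrite leNgt (lt_trans hq hj) => /(_ _)/negP; apply => //.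
by move=> i; rewrite mxE.
Qed.

Lemma measurable_corrI C phi : measurable_corr C -> caratheodory phi ->
  measurable_corr (fun w => [set v | C w v /\ phi w v <= 0]).
Proof.
move=> mC cphi h ch.
rewrite (_ : [set w | _] = [set w | exists2 v, C w v & Num.max (phi w v) (h w v) <= 0]).
  exact/mC/caratheodory_max.
apply/seteqP; split => w /=.
  by move=> [v [Cv p0] h0]; exists v => //; rewrite ge_max p0.
by move=> [v Cv]; rewrite ge_max => /andP[p0 h0]; exists v.
Qed.

Lemma measurable_corr_le0 phi : caratheodory phi ->
  measurable_corr (fun w => [set v | phi w v <= 0]).
Proof.
move=> cphi h ch.
rewrite (_ : [set w | _] = \bigcup_(m : nat)
    [set w | exists2 v, box m v /\ phi w v <= 0 & h w v <= 0]).
  apply: bigcupT_measurable => m.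
  exact: (measurable_corrI (@measurable_corr_box m) cphi ch).
apply/seteqP; split => w /=; last by move=> [m _ [v [_ p0] h0]]; exists v.
move=> [v p0 h0]; exists (Num.bound (\sum_i `|v 0 i|)) => //.
exists v => //; split => // i.
apply: le_trans (ltW (archi_boundP _)); last by apply: sumr_ge0.
by rewrite (bigD1 i)//= lerDl sumr_ge0.
Qed.

Definition argmin phi C w : set 'rV[R]_N :=
  [set v | C w v /\ forall u, C w u -> phi w v <= phi w u].

Lemma compact_argmin phi C w : compact (C w) -> continuous (phi w) ->
  compact (argmin phi C w).
Proof.
move=> cC cphi; have [C0|] := pselect (C w !=set0); last first.
  move=> C0; rewrite (_ : argmin _ _ _ = set0); first exact: compact0.
  by apply/seteqP; split => // v [Cv _]; apply: C0; exists v.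
have [v Cv vmin] := compact_min C0 cC cphi.
rewrite (_ : argmin _ _ _ = [set u | C w u /\ phi w u - phi w v <= 0]).
  apply: (compact_le0 (h := fun w u => phi w u - phi w v) cC) => u.
  by apply: cvgB; [exact: nbhs_filter|exact: cphi|apply: cvg_cst; exact: nbhs_filter].
apply/seteqP; split => u /= [Cu hu]; split => //; first by rewrite subr_le0 hu.
by move=> x Cx; apply: le_trans (vmin _ Cx); rewrite -subr_le0.
Qed.

Lemma argmin_nonempty phi C w : compact (C w) -> continuous (phi w) ->
  C w !=set0 -> argmin phi C w !=set0.
Proof.
by move=> cC cphi C0; have [v Cv vmin] := compact_min C0 cC cphi; exists v.
Qed.

(** The function [h] is nonpositive at some minimizer iff the minimum of [phi] over
    [C w] is already attained on the part where [h] is nonpositive: no rational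
    level reached by [phi] on [C w] is missed on this part. *)
Lemma measurable_argmin phi C : (forall w, compact (C w)) -> measurable_corr C ->
  caratheodory phi -> measurable_corr (argmin phi C).
Proof.
move=> cC mC cphi h ch.
have [_ cphi2] := cphi; have [_ ch2] := ch.
pose lev (c : rat) := [set w | exists2 v, C w v & phi w v - ratr c <= 0].
pose lev2 (c : rat) :=
  [set w | exists2 v, C w v & Num.max (h w v) (phi w v - ratr c) <= 0].
rewrite (_ : [set w | _] = [set w | exists2 v, C w v & h w v <= 0] `&`
    ~` (\bigcup_(c : rat) (lev c `&` ~` lev2 c))).
  apply: measurableI; first exact: mC.
  apply: measurableC; apply: bigcupT_measurable_rat => c.
  apply: measurableI; first exact/mC/caratheodoryB_cst.
  by apply/measurableC/mC/caratheodory_max => //; exact: caratheodoryB_cst.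
apply/seteqP; split => w /=.
  move=> [v [Cv vmin] h0]; split; first by exists v.
  move=> [c _ [[u Cu uc] n2]]; apply: n2; exists v => //.
  by rewrite ge_max h0/= (le_trans _ uc)// lerD2r vmin.
move=> [[v0 Cv0 hv0] H].
have [v [Cv hv] vmin] := compact_min (ex_intro _ v0 (conj Cv0 hv0))
  (compact_le0 (cC w) (ch2 w)) (cphi2 w).
exists v => //; split => // u Cu; rewrite leNgt; apply/negP => uv.
have [c] := rat_in_itvoo uv; rewrite in_itv/= => /andP[uc cv].
apply: H; exists c => //; split; first by exists u => //; rewrite subr_le0 ltW.
move=> [x Cx]; rewrite ge_max subr_le0 => /andP[hx xc].
by have := vmin x (conj Cx hx); rewrite leNgt (le_lt_trans xc cv).
Qed.

Lemma caratheodory_coord i : caratheodory (fun _ v => v 0 i).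
Proof.
split=> [v|w]; first exact: measurable_cst.
exact: coord_continuous.
Qed.

Let coord (i : 'I_N) : T -> 'rV[R]_N -> R := fun _ v => v 0 i.

Let lexmin C (s : seq 'I_N) := foldl (fun C i => argmin (coord i) C) C s.

Let lexminP C s : (forall w, compact (C w)) -> measurable_corr C ->
  [/\ forall w, compact (lexmin C s w), measurable_corr (lexmin C s),
      forall w, C w !=set0 -> lexmin C s w !=set0,
      forall w, lexmin C s w `<=` C w &
      forall w u v i, i \in s -> lexmin C s w u -> lexmin C s w v -> u 0 i = v 0 i].
Proof.
elim: s C => [|i s IH] C cC mC /=; first by split => // w v.
have cc : caratheodory (coord i) := caratheodory_coord i; have [_ cci] := cc.
have cC' w : compact (argmin (coord i) C w) by apply: compact_argmin.
have mC' : measurable_corr (argmin (coord i) C) by apply: measurable_argmin.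
have [h1 h2 h3 h4 h5] := IH _ cC' mC'; split => //.
- by move=> w C0; apply: h3; exact: argmin_nonempty.
- by move=> w v /h4[].
- move=> w u v j; rewrite inE => /orP[/eqP->{j}|]; last exact: h5.
  move=> /h4[Cu umin] /h4[Cv vmin]; apply/eqP; rewrite eq_le.
  by rewrite [X in X && _](umin _ Cv) [X in _ && X](vmin _ Cu).
Qed.

(** Minimizing the coordinates one after the other shrinks each value to a single
    point, whose coordinates are then measurable. *)
Lemma measurable_selection C : (forall w, compact (C w)) -> measurable_corr C ->
  exists v : T -> 'rV[R]_N, (forall i, measurable_fun setT (fun w => v w 0 i)) /\
    forall w, C w !=set0 -> C w (v w).
Proof.
move=> cC mC.
(* [L w] is empty or a single point. *)
have [_ mL neL subL uniL] := lexminP (enum 'I_N) cC mC.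
set L := lexmin C (enum 'I_N) in mL neL subL uniL.
have ex w : exists v, L w !=set0 -> L w v.
  have [[v Lv]|n] := pselect (L w !=set0); first by exists v.
  by exists 0 => /n.
pose v w := if pselect (L w !=set0) is left _ then sval (cid (ex w)) else 0.
have vL w : L w !=set0 -> L w (v w).
  by move=> ne; rewrite /v; case: pselect => // _; case: cid => /= x; apply.
exists v; split; last by move=> w /neL/vL; exact: subL.
move=> i mT.
have mU : measurable [set w | L w !=set0].
  rewrite (_ : [set w | _] = [set w | exists2 v, L w v & 0 <= 0 :> R]).
    apply: (mL (fun _ _ => 0)); split=> [u|w u]; first exact: measurable_cst.
    by apply: cvg_cst; exact: nbhs_filter.
  by apply/seteqP; split => w /= [u Lu]; exists u.
apply: (measurability _ (RGenOInfty.measurableE R)) => //.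
move=> _ [_ [c ->] <-]; rewrite setTI.
have mle : measurable [set w | exists2 u, L w u & u 0 i - c <= 0].
  exact/mL/(caratheodoryB_cst c (caratheodory_coord i)).
rewrite (_ : _ @^-1` _ = ([set w | L w !=set0] `&`
     ~` [set w | exists2 u, L w u & u 0 i - c <= 0]) `|`
     (~` [set w | L w !=set0] `&` [set w | c < 0])).
  apply: measurableU; first by apply: measurableI => //; exact: measurableC.
  apply: measurableI; first exact: measurableC.
  by have [c0|c0] := pselect (c < 0); [rewrite (_ : [set w | _] = setT)|rewrite (_ : [set w | _] = set0)];
    rewrite //; apply/seteqP; split.
apply/seteqP; split => w /=; rewrite in_itv/= andbT.
  have [ne|ne] := pselect (L w !=set0) => cv.
    left; split => // -[u Lu]; rewrite subr_le0 => uc.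
    move: cv; rewrite (uniL w (v w) u i) ?mem_enum//; last exact: vL.
    by rewrite ltNge uc.
  right; split => //; move: cv; rewrite /v; case: pselect => // _.
  by rewrite mxE.
move=> [[ne nle]|[ne c0]].
  rewrite ltNge; apply/negP => vc; apply: nle; exists (v w); first exact: vL.
  by rewrite subr_le0.
by rewrite /v; case: pselect => // _; rewrite mxE.
Qed.

End MeasurableSelection.

(** * Whitening a positive definite matrix *)

Section Cholesky.
Context {R : rcfType}.

Definition posdef p (M : 'M[R]_p) :=
  M^T = M /\ forall x : 'rV[R]_p, x != 0 -> 0 < (x *m M *m x^T) 0 0.

(** One step of symmetric Gaussian elimination: the Schur complement of the
    corner stays positive definite, and is close to the identity when the matrix
    is, so a single induction gives both existence and continuity at the
    identity. *)
Lemma posdef_whitening_near p (eta : R) : 0 < eta ->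
  exists2 eps : R, 0 < eps & forall M : 'M[R]_p, posdef M ->
    exists2 G : 'M[R]_p, G *m M *m G^T = 1%:M &
      (forall i j, `|M i j - (i == j)%:R| <= eps) ->
      forall i j, `|G i j - (i == j)%:R| <= eta.
Proof.
elim: p eta => [|p IH] eta eta0.
  exists 1 => // M _; exists 1%:M; first by rewrite [LHS]flatmx0 [RHS]flatmx0.
  by move=> _ [].
pose eta' := Num.min eta 1.
have eta'0 : 0 < eta' by rewrite lt_min eta0 ltr01.
have [eps' eps'0 {}IH] := IH _ eta'0.
pose eps := Num.min (Num.min 2^-1 (eps' / 2)) (Num.min (eta / 2) (eta / (4 * p%:R + 1))).
have p0 : 0 < 4 * p%:R + 1 :> R by rewrite ltr_wpDl// mulr_ge0.
have eps0 : 0 < eps by rewrite !lt_min !divr_gt0// invr_gt0 ltr0n.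
have eps_half : eps <= 2^-1 by rewrite /eps ge_min ge_min lexx.
have eps_eps' : eps <= eps' / 2 by rewrite /eps ge_min ge_min lexx orbT.
have eps_eta : eps <= eta / 2 by rewrite /eps !ge_min lexx !orbT.
have eps_etap : eps <= eta / (4 * p%:R + 1) by rewrite /eps !ge_min lexx !orbT.
exists eps => // M' [Msym Mpos].
pose M : 'M[R]_(1 + p) := M'.
have MT : M^T = M by exact: Msym.
have Mpos1 (x : 'rV[R]_(1 + p)) : x != 0 -> 0 < (x *m M *m x^T) 0 0 by exact: Mpos.
pose a := M 0 0.
pose b := ursubmx M; pose D := drsubmx M.
have ME : M = block_mx a%:M b b^T D.
  rewrite -[LHS]submxK; congr block_mx.
    by rewrite [LHS]mx11_scalar /a; congr (_%:M); rewrite !mxE; congr (M _ _); apply: val_inj.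
  by rewrite /b trmx_ursub MT.
have a0 : 0 < a.
  have := Mpos1 (row_mx (1%:M : 'M[R]_1) 0 : 'rV[R]_(1 + p)).
  rewrite ME mul_row_block !mul1mx !mul0mx !addr0 tr_row_mx mul_row_col.
  rewrite trmx1 mulmx1 trmx0 mulmx0 addr0 mxE eqxx mulr1n; apply.
  apply/eqP => /(congr1 (fun N : 'rV[R]_(1 + p) => N 0 (lshift p 0))).
  by rewrite row_mxEl !mxE eqxx => /eqP; rewrite oner_eq0.
have an0 : a != 0 by rewrite gt_eqF.
(* The Schur complement of the corner [a]. *)
pose S := D - a^-1 *: (b^T *m b).
have Dsym : D^T = D by rewrite /D trmx_drsub MT.
have Spd : posdef S.
  split; first by rewrite /S linearB linearZ/= trmx_mul trmxK Dsym.
  move=> y y0.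
  have := Mpos1 (row_mx (- a^-1 *: (y *m b^T)) y : 'rV[R]_(1 + p)).
  rewrite ME mul_row_block tr_row_mx mul_row_col.
  have -> : - a^-1 *: (y *m b^T) *m a%:M + y *m b^T = 0.
    by rewrite mul_mx_scalar scalerA mulrN mulfV// scaleN1r addNr.
  rewrite mul0mx add0r.
  have -> : - a^-1 *: (y *m b^T) *m b + y *m D = y *m S.
    by rewrite /S mulmxBr -scalemxAl scaleNr addrC -scalemxAr mulmxA.
  apply; apply: contra_neq y0 => /(congr1 (@rsubmx _ 1 1 p)).
  by rewrite row_mxKr linear0.
have [G' G'S G'near] := IH _ Spd.
pose al := (Num.sqrt a)^-1.
have al2 : al * al * a = 1.
  have s0 : Num.sqrt a != 0 by rewrite gt_eqF// sqrtr_gt0.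
  rewrite -[a in X in _ * X](sqr_sqrtr (ltW a0)) /al; field.
  by [].
have al0 : 0 < al by rewrite invr_gt0 sqrtr_gt0.
pose c := - a^-1 *: (G' *m b^T).
pose G : 'M[R]_(1 + p) := block_mx al%:M 0 c G'.
exists G; first change (G *m M *m G^T = 1%:M :> 'M[R]_(1 + p)).
  rewrite ME /G mulmx_block !mul0mx !addr0 tr_block_mx mulmx_block.
  rewrite trmx0 !mulmx0 !addr0 tr_scalar_mx.
  have -> : c *m a%:M + G' *m b^T = 0.
    by rewrite mul_mx_scalar scalerA mulrN mulfV// scaleN1r addNr.
  have -> : c *m b + G' *m D = G' *m S.
    by rewrite /S mulmxBr -scalemxAl scaleNr addrC -scalemxAr mulmxA.
  rewrite !mul0mx add0r G'S [RHS](@scalar_mx_block _ 1 p); congr block_mx.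
  - rewrite -!scalar_mxM; congr (_%:M); rewrite -al2; ring.
  - rewrite -scalar_mxM mul_scalar_mx linearZ/= trmx_mul trmxK.
    rewrite mul_scalar_mx -scalemxAl scalerA mulrN mulfK// scaleNr.
    by rewrite addNr.
move=> near.
have near1 (i j : 'I_(1 + p)) : `|M i j - (i == j)%:R| <= eps by exact: near.
have near_a : `|a - 1| <= eps by have := near 0 0; rewrite eqxx.
have a_half : 2^-1 <= a by move: near_a; rewrite ler_norml => /andP[]; lra.
have aV : a^-1 <= 2 by rewrite invf_ple ?posrE.
have near_b j : `|b 0 j| <= eps.
  have := near1 (lshift p (0 : 'I_1)) (rshift 1 j).
  by rewrite (_ : (_ == _) = false) ?subr0 ?mxE//.
have near_D i j : `|D i j - (i == j)%:R| <= eps.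
  have := near1 (rshift 1 i) (rshift 1 j).
  by rewrite (inj_eq (@rshift_inj 1 p)) /D !mxE.
have near_S i j : `|S i j - (i == j)%:R| <= eps'.
  rewrite /S !mxE big_ord1 !mxE.
  rewrite addrAC; apply: le_trans (ler_normB _ _) _.
  have h1 := near_D i j.
  have h2 : `|a^-1 * (b 0 i * b 0 j)| <= 2 * (eps * 2^-1).
    rewrite normrM; apply: ler_pM => //; first by rewrite gtr0_norm ?invr_gt0.
    rewrite normrM; apply: ler_pM => //; exact: le_trans (near_b j) eps_half.
  move: h1 h2; rewrite /b !mxE; lra.
have {}G'near := G'near near_S.
have G'2 i j : `|G' i j| <= 2.
  have h1 := G'near i j; have h2 : eta' <= 1 by rewrite ge_min lexx orbT.
  have h3 : `|(i == j)%:R| <= 1 :> R by case: (i == j); rewrite ?normr1 ?normr0.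
  rewrite -[G' i j](subrK (i == j)%:R).
  by apply: le_trans (ler_normD _ _) _; lra.
have near_c i : `|c i 0| <= eta.
  have aVn : `|- a^-1| = a^-1 by rewrite normrN gtr0_norm ?invr_gt0.
  rewrite mxE normrM aVn mxE.
  apply: (@le_trans _ _ (2 * (\sum_(j < p) 2 * eps))).
    apply: ler_pM; [by rewrite invr_ge0 ltW|by []|by []|].
    apply: le_trans (ler_norm_sum _ _ _) _; apply: ler_sum => j _.
    by rewrite normrM; apply: ler_pM => //; rewrite [b^T _ _]mxE.
  rewrite sumr_const card_ord -mulr_natr.
  have h : eps * (4 * p%:R + 1) <= eta by rewrite -ler_pdivlMr.
  by apply: le_trans h; nra.
have near_al : `|al - 1| <= eta.
  have h : `|al - 1| * (al + 1) = `|1 - a| / a.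
    rewrite -[al + 1]gtr0_norm ?addr_gt0// -normrM -[a^-1]gtr0_norm ?invr_gt0// -normrM.
    congr `|_|; rewrite [RHS]mulrBl mulfV// mul1r (_ : a^-1 = al * al); first by ring.
    by apply: (mulIf an0); rewrite mulVf// al2.
  apply: (@le_trans _ _ (`|al - 1| * (al + 1))).
    by rewrite ler_peMr// lerDr ltW.
  rewrite h distrC; apply: (@le_trans _ _ (eps * 2)); last by lra.
  by apply: ler_pM => //; rewrite invr_ge0 ltW.
change (forall i j : 'I_(1 + p), `|G i j - (i == j)%:R| <= eta).
move=> i j; rewrite /G.
case: (@split_ordP 1 p i) => i' ->; case: (@split_ordP 1 p j) => j' ->.
- by rewrite block_mxEul !ord1 !mxE !eqxx.
- by rewrite block_mxEur eq_lrshift mxE subrr normr0 ltW.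
- by rewrite block_mxEdl eq_rlshift subr0 ord1; exact: near_c.
- rewrite block_mxEdr (inj_eq (@rshift_inj 1 p)).
  by apply: le_trans (G'near i' j') _; rewrite ge_min lexx.
Qed.

End Cholesky.

(** * Feasible matrices for nearly white data *)

Section NearMaximizer.
Context {R : realType}.

Lemma sqr_sum_norm_le p (x : 'I_p -> R) :
  (\sum_a `|x a|) ^+ 2 <= p%:R * \sum_a x a ^+ 2.
Proof.
have -> : (\sum_a `|x a|) ^+ 2 = \sum_a \sum_b `|x a| * `|x b|.
  by rewrite expr2 mulr_suml; apply: eq_bigr => a _; rewrite mulr_sumr.
apply: (@le_trans _ _ (\sum_a \sum_b (x a ^+ 2 + x b ^+ 2) / 2)).
  apply: ler_sum => a _; apply: ler_sum => b _.
  rewrite -(real_normK (num_real (x a))) -(real_normK (num_real (x b))).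
  have := sqr_ge0 (`|x a| - `|x b|); nra.
have -> : \sum_a \sum_b (x a ^+ 2 + x b ^+ 2) / 2 =
    (\sum_(a < p) \sum_(b < p) x a ^+ 2 + \sum_(a < p) \sum_(b < p) x b ^+ 2) / 2.
  rewrite -big_split/= mulr_suml; apply: eq_bigr => a _.
  by rewrite -big_split/= mulr_suml.
rewrite [X in _ + X]exchange_big/=.
have -> : \sum_(a < p) \sum_(b < p) x a ^+ 2 = p%:R * \sum_a x a ^+ 2.
  by rewrite mulr_sumr; apply: eq_bigr => a _; rewrite sumr_const card_ord mulr_natl.
lra.
Qed.

(** The Cauchy-Schwarz inequality turns the entrywise bound on the perturbation into
    a bound by the squared length of the vector. *)
Lemma perturbed_form_le p (x : 'I_p -> R) (E : 'I_p -> 'I_p -> R) (e : R) :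
  0 <= e -> (forall a b, `|E a b| <= e) ->
  `|\sum_a \sum_b x a * E a b * x b| <= e * p%:R * \sum_a x a ^+ 2.
Proof.
move=> e0 Ee; rewrite -mulrA; apply: le_trans (ler_wpM2l e0 (sqr_sum_norm_le x)).
rewrite expr2 mulr_suml mulr_sumr; apply: le_trans (ler_norm_sum _ _ _) _.
apply: ler_sum => a _; rewrite mulr_sumr mulr_sumr.
apply: le_trans (ler_norm_sum _ _ _) _; apply: ler_sum => b _.
rewrite !normrM mulrAC mulrC; apply: ler_wpM2r; first by rewrite mulr_ge0.
exact: Ee.
Qed.

Lemma quad_formE p (u v : 'rV[R]_p) (M : 'M[R]_p) :
  (u *m M *m v^T) 0 0 = \sum_a \sum_b u 0 a * M a b * v 0 b.
Proof.
rewrite mxE exchange_big/=; apply: eq_bigr => b _.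
by rewrite !mxE mulr_suml.
Qed.

Lemma posdef_near1 p (M : 'M[R]_p) (e : R) : 0 <= e -> e * p%:R < 1 -> M^T = M ->
  (forall a b, `|M a b - (a == b)%:R| <= e) -> posdef M.
Proof.
move=> e0 ep MT Me; split => // x x0.
have xx0 : 0 < \sum_a x 0 a ^+ 2.
  rewrite lt_neqAle sumr_ge0 ?andbT; last by move=> a _; exact: sqr_ge0.
  apply: contra_neq x0 => /esym/eqP; rewrite psumr_eq0 => [/allP h|a _]; last exact: sqr_ge0.
  apply/rowP => a; rewrite mxE; have := h a (mem_index_enum _).
  by rewrite /= sqrf_eq0 => /eqP.
have h := perturbed_form_le (x 0) e0 Me.
have E : \sum_a \sum_b x 0 a * (M a b - (a == b)%:R) * x 0 b =
    (x *m M *m x^T) 0 0 - \sum_a x 0 a ^+ 2.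
  rewrite quad_formE -sumrB; apply: eq_bigr => a _.
  rewrite (bigD1 a)//= [X in _ = X - _](bigD1 a)//= eqxx.
  rewrite (eq_bigr (fun b => x 0 a * M a b * x 0 b)).
    by rewrite expr2 /=; ring.
  by move=> b ba; rewrite eq_sym (negbTE ba) subr0.
rewrite E in h; move: h; rewrite ler_norml => /andP[h _].
have : (1 - e * p%:R) * \sum_a x 0 a ^+ 2 > 0 by rewrite mulr_gt0// subr_gt0.
by lra.
Qed.

Section NearOrthogonal.
Variables (p : nat) (M G : 'M[R]_p) (e : R).
Hypotheses (e0 : 0 <= e) (ep : e * p%:R <= 2^-1).
Hypothesis Me : forall a b, `|M a b - (a == b)%:R| <= e.
Hypothesis GM : feasible M G.

Let rowE j j' : \sum_a \sum_b G j a * M a b * G j' b = (j == j')%:R.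
Proof.
have := congr1 (fun N : 'M[R]_p => N j j') GM; rewrite [X in _ = X]mxE => <-.
rewrite mxE exchange_big/=; apply: eq_bigr => b _.
by rewrite !mxE mulr_suml.
Qed.

Let rowD j : \sum_a \sum_b G j a * (M a b - (a == b)%:R) * G j b =
  1 - \sum_a G j a ^+ 2.
Proof.
have h1 : \sum_a \sum_b G j a * M a b * G j b = 1 by rewrite rowE eqxx.
rewrite -[X in _ = X - _]h1 -sumrB; apply: eq_bigr => a _.
rewrite (bigD1 a)//= [X in _ = X - _](bigD1 a)//= eqxx.
rewrite (eq_bigr (fun b => G j a * M a b * G j b)).
  by rewrite expr2 /=; ring.
by move=> b ba; rewrite eq_sym (negbTE ba) subr0.
Qed.

Let rowS_ge0 j : 0 <= \sum_a G j a ^+ 2.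
Proof. by apply: sumr_ge0 => a _; exact: sqr_ge0. Qed.

(** The form of [M] is 1 on each row of [G] and differs from the squared length of
    the row by at most half of it. *)
Lemma feasible_row_le2 j : \sum_a G j a ^+ 2 <= 2.
Proof.
have := perturbed_form_le (G j) e0 Me; rewrite rowD ler_norml => /andP[h _].
have := rowS_ge0 j; have := ler_wpM2r (rowS_ge0 j) ep; lra.
Qed.

Lemma feasible_row j : `|\sum_a G j a ^+ 2 - 1| <= 2 * p%:R * e.
Proof.
have := perturbed_form_le (G j) e0 Me; rewrite rowD distrC.
move=> /le_trans; apply; have := feasible_row_le2 j.
have h : 0 <= e * p%:R by rewrite mulr_ge0.
move=> /(ler_wpM2l h); lra.
Qed.

(** Feasibility makes [G^T *m G] an inverse of [M], so it differs from the identity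
    by [(1 - M) *m (G^T *m G)], which is small since [G^T *m G] is bounded. *)
Lemma feasible_col a : `|\sum_j G j a ^+ 2 - 1| <= 2 * p%:R ^+ 2 * e.
Proof.
have GGM : M *m (G^T *m G) = 1%:M.
  by rewrite mulmxA; apply: mulmx1C; rewrite mulmxA; exact: GM.
have le2 b c : `|(G^T *m G) b c| <= 2 * p%:R.
  rewrite mxE; apply: le_trans (ler_norm_sum _ _ _) _.
  rewrite mulr_natr -[p in _ *+ p]card_ord -sumr_const; apply: ler_sum => j _.
  rewrite mxE normrM; apply: le_trans (feasible_row_le2 j).
  have hc d : G j d ^+ 2 <= \sum_a G j a ^+ 2.
    by rewrite [leRHS](bigD1 d)//= lerDl sumr_ge0// => ? _; exact: sqr_ge0.
  have := hc b; have := hc c; rewrite -[G j b ^+ 2]real_normK ?num_real//.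
  rewrite -[G j c ^+ 2]real_normK ?num_real//.
  have := sqr_ge0 (`|G j b| - `|G j c|); nra.
have E : \sum_j G j a ^+ 2 - 1 =
    - \sum_b (M a b - (a == b)%:R) * (G^T *m G) b a.
  have h1 : (M *m (G^T *m G)) a a = 1 by rewrite GGM mxE eqxx.
  rewrite -[X in _ - X = _]h1.
  have -> : \sum_j G j a ^+ 2 = (G^T *m G) a a.
    by rewrite mxE; apply: eq_bigr => j _; rewrite !mxE expr2.
  rewrite [(M *m _) a a]mxE.
  have -> : (G^T *m G) a a = \sum_b (a == b)%:R * (G^T *m G) b a.
    rewrite (bigD1 a)//= eqxx mul1r big1 ?addr0// => b ba.
    by rewrite eq_sym (negbTE ba) mul0r.
  by rewrite -sumrB -sumrN; apply: eq_bigr => b _; rewrite mulrBl opprB.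
rewrite E normrN; apply: le_trans (ler_norm_sum _ _ _) _.
apply: (@le_trans _ _ (\sum_(b < p) e * (2 * p%:R))).
  by apply: ler_sum => b _; rewrite normrM; apply: ler_pM.
rewrite sumr_const card_ord -[leLHS]mulr_natr; lra.
Qed.

Lemma row_form_near j (N : 'M[R]_p) (lam : 'I_p -> R) :
  (forall a b, `|N a b - lam a *+ (a == b)| <= e) ->
  `|(row j G *m N *m (row j G)^T) 0 0 - \sum_a G j a ^+ 2 * lam a| <= 2 * p%:R * e.
Proof.
move=> Ne.
have -> : (row j G *m N *m (row j G)^T) 0 0 - \sum_a G j a ^+ 2 * lam a =
    \sum_a \sum_b G j a * (N a b - lam a *+ (a == b)) * G j b.
  rewrite quad_formE -sumrB; apply: eq_bigr => a _.
  under eq_bigr do rewrite !mxE.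
  rewrite (bigD1 a)//= [RHS](bigD1 a)//= eqxx mulr1n.
  rewrite [in RHS](eq_bigr (fun b => G j a * N a b * G j b)).
    by rewrite expr2; ring.
  by move=> b ba; rewrite eq_sym (negbTE ba) mulr0n subr0.
apply: le_trans (perturbed_form_le (G j) e0 Ne) _.
have h : 0 <= e * p%:R by rewrite mulr_ge0.
have := ler_wpM2l h (feasible_row_le2 j); lra.
Qed.

End NearOrthogonal.

(** Lagrange's identity for the variance of [lam] under the weights [w]: it shows
    that the deficit of Jensen's inequality controls each pair of weights. *)
Lemma weighted_variance p (w lam : 'I_p -> R) :
  (\sum_a w a) * (\sum_a w a * lam a ^+ 2) - (\sum_a w a * lam a) ^+ 2 =
  2^-1 * \sum_a \sum_b w a * w b * (lam a - lam b) ^+ 2.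
Proof.
have -> : \sum_a \sum_b w a * w b * (lam a - lam b) ^+ 2 =
   \sum_a \sum_b w a * (w b * lam b ^+ 2) + \sum_a \sum_b w b * (w a * lam a ^+ 2)
   - 2 * \sum_a \sum_b (w a * lam a) * (w b * lam b).
  rewrite mulr_sumr -big_split/= -sumrB; apply: eq_bigr => a _.
  rewrite mulr_sumr -big_split/= -sumrB; apply: eq_bigr => b _; ring.
rewrite [X in _ + X - _]exchange_big/=.
have -> : \sum_a \sum_b w a * (w b * lam b ^+ 2) = (\sum_a w a) * \sum_a w a * lam a ^+ 2.
  by rewrite mulr_suml; apply: eq_bigr => a _; rewrite mulr_sumr.
have -> : \sum_a \sum_b w a * lam a * (w b * lam b) = (\sum_a w a * lam a) ^+ 2.
  by rewrite expr2 mulr_suml; apply: eq_bigr => a _; rewrite mulr_sumr.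
by field.
Qed.

Lemma weighted_variance_ge p (w lam : 'I_p -> R) a b : a != b ->
  (forall a, 0 <= w a) -> w a * w b * (lam a - lam b) ^+ 2 <=
  (\sum_a w a) * (\sum_a w a * lam a ^+ 2) - (\sum_a w a * lam a) ^+ 2.
Proof.
move=> ab w0; rewrite weighted_variance.
pose t c d := w c * w d * (lam c - lam d) ^+ 2.
have t0 c d : 0 <= t c d.
  by apply: mulr_ge0; [exact: mulr_ge0|exact: sqr_ge0].
have tle c d : t c d <= \sum_d t c d by rewrite (bigD1 d)//= lerDl sumr_ge0.
have : t a b + t b a <= \sum_c \sum_d t c d.
  rewrite (bigD1 a)//= [X in _ <= _ + X](bigD1 b) 1?eq_sym//= addrA.
  apply: (@le_trans _ _ (\sum_d t a d + \sum_d t b d)); first exact: lerD.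
  by rewrite lerDl sumr_ge0// => c _; exact: sumr_ge0.
have -> : t b a = t a b by rewrite /t; ring.
rewrite -/(t a b); lra.
Qed.

End NearMaximizer.

(** * Maximizers are nearly signed permutations *)

Section SignedPermutation.
Context {R : realType}.

(** The loss of the objective of a nearly doubly stochastic [W] is a sum of
    variances, one of which contains the product of two weights of a same row. *)
Lemma row_weights_product_le p k (W : 'I_p -> 'I_p -> R) (lam : 'I_k -> 'I_p -> R)
    (C delta tau : R) :
  (forall j a, 0 <= W j a) -> 0 <= tau <= 1 -> 0 <= delta ->
  (forall j, `|\sum_a W j a - 1| <= tau) ->
  (forall a, `|\sum_j W j a - 1| <= tau) ->
  (forall l a, `|lam l a| <= C) ->
  (forall a b, a != b -> exists l, delta <= `|lam l a - lam l b|) ->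
  \sum_l \sum_a lam l a ^+ 2 - tau <= \sum_l \sum_j (\sum_a W j a * lam l a) ^+ 2 ->
  forall j a b, a != b ->
    W j a * W j b * delta ^+ 2 <= (3 * (k%:R * p%:R * C ^+ 2) + 1) * tau.
Proof.
move=> W0 /andP[t0 t1] d0 row col lamC sep obj j a b ab.
pose V l j := (\sum_a W j a) * (\sum_a W j a * lam l a ^+ 2) - (\sum_a W j a * lam l a) ^+ 2.
have V0 l j' : 0 <= V l j'.
  rewrite /V weighted_variance mulr_ge0// sumr_ge0// => c _; rewrite sumr_ge0// => d _.
  by apply: mulr_ge0; [exact: mulr_ge0|exact: sqr_ge0].
have [l ldel] := sep a b ab.
have VS : W j a * W j b * delta ^+ 2 <= \sum_l \sum_j V l j.
  apply: (@le_trans _ _ (V l j)); last first.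
    rewrite (bigD1 l)//= [X in _ <= X + _](bigD1 j)//= -addrA lerDl.
    by rewrite addr_ge0 ?sumr_ge0// => c _; exact: sumr_ge0.
  apply: le_trans (weighted_variance_ge (lam l) ab (W0 j)).
  rewrite ler_wpM2l ?mulr_ge0// -[leRHS]real_normK ?num_real//.
  by rewrite ler_pXn2r ?nnegrE.
apply: le_trans VS _.
pose L := \sum_l \sum_a lam l a ^+ 2.
have LC : L <= k%:R * p%:R * C ^+ 2.
  apply: (@le_trans _ _ (\sum_(l < k) \sum_(a < p) C ^+ 2)).
    apply: ler_sum => l' _; apply: ler_sum => c _.
    rewrite -[leLHS]real_normK ?num_real// ler_pXn2r// nnegrE//.
    exact: le_trans (lamC l' c).
  by rewrite !sumr_const !card_ord -mulrA !mulr_natl.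
have L0 : 0 <= L by apply: sumr_ge0 => ? _; apply: sumr_ge0 => ? _; exact: sqr_ge0.
have main : \sum_l \sum_j (\sum_a W j a) * (\sum_a W j a * lam l a ^+ 2) <= (1 + tau) ^+ 2 * L.
  rewrite /L mulr_sumr; apply: ler_sum => l' _.
  apply: (@le_trans _ _ (\sum_j (1 + tau) * (\sum_a W j a * lam l' a ^+ 2))).
    apply: ler_sum => j' _; apply: ler_wpM2r.
      by apply: sumr_ge0 => c _; apply: mulr_ge0 => //; exact: sqr_ge0.
    by have := row j'; rewrite ler_norml => /andP[_]; lra.
  rewrite -mulr_sumr exchange_big/= expr2 -mulrA; apply: ler_wpM2l; first by lra.
  rewrite mulr_sumr; apply: ler_sum => c _; rewrite -mulr_suml.
  apply: ler_wpM2r; first exact: sqr_ge0.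
  by have := col c; rewrite ler_norml => /andP[_]; lra.
have -> : \sum_l \sum_j V l j = \sum_l \sum_j (\sum_a W j a) * (\sum_a W j a * lam l a ^+ 2)
    - \sum_l \sum_j (\sum_a W j a * lam l a) ^+ 2.
  by rewrite -sumrB; apply: eq_bigr => ? _; rewrite -sumrB.
have tt : tau * tau <= tau by rewrite ler_piMr.
have h1 := ler_wpM2r L0 tt; have h2 := ler_wpM2r t0 LC.
have h3 : (1 + tau) ^+ 2 * L <= L + 3 * (tau * L) by lra.
have h4 : L - tau <= \sum_l \sum_j (\sum_a W j a * lam l a) ^+ 2 by exact: obj.
lra.
Qed.

(** The largest weight of a row is at least [1 / (2 * p)], so that the other ones are
    of the order of [kap] and the largest one is close to 1; two rows cannot share
    the column of their largest weight, whose sum would be near 2. *)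
Lemma nearly_permutation p (W : 'I_p -> 'I_p -> R) (tau kap : R) :
  (forall j a, 0 <= W j a) ->
  tau <= 1 / 8 -> 2 * p%:R ^+ 2 * kap <= 1 / 8 -> 0 <= kap ->
  (forall j, `|\sum_a W j a - 1| <= tau) ->
  (forall a, `|\sum_j W j a - 1| <= tau) ->
  (forall j a b, a != b -> W j a * W j b <= kap) ->
  exists s : {perm 'I_p}, forall j,
    `|W j (s j) - 1| <= tau + 2 * p%:R ^+ 2 * kap /\
    forall b, b != s j -> W j b <= 2 * p%:R * kap.
Proof.
move=> W0 t8 k8 k0 row col prod.
have exs (j : 'I_p) : exists a, forall b, W j b <= W j a.
  exists [arg max_(a > j) W j a]%O.
  by case: arg_maxP => // a _ h b; exact: h.
pose s j := sval (cid (exs j)).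
have smax j b : W j b <= W j (s j) by rewrite /s; case: cid.
have big_s j : 1 <= 2 * p%:R * W j (s j).
  have h : \sum_a W j a <= p%:R * W j (s j).
    rewrite mulr_natl -[p in _ *+ p]card_ord -sumr_const.
    by apply: ler_sum => a _; exact: smax.
  by have := row j; rewrite ler_norml => /andP[h1 _]; lra.
have small j b : b != s j -> W j b <= 2 * p%:R * kap.
  move=> bs; have h := prod j b (s j) bs.
  apply: (@le_trans _ _ (W j b * (2 * p%:R * W j (s j)))); first by rewrite ler_peMr.
  by rewrite mulrCA; apply: ler_wpM2l.
have rest j : \sum_(a | a != s j) W j a <= 2 * p%:R ^+ 2 * kap.
  apply: (@le_trans _ _ (\sum_(a < p) 2 * p%:R * kap)).
    rewrite big_mkcond/=; apply: ler_sum => a _; case: ifPn => [|_]; first exact: small.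
    by rewrite !mulr_ge0.
  by rewrite sumr_const card_ord -[leLHS]mulr_natr; lra.
have near1 j : `|W j (s j) - 1| <= tau + 2 * p%:R ^+ 2 * kap.
  have := row j; rewrite (bigD1 (s j))//= => h1; have h2 := rest j.
  have h3 : 0 <= \sum_(a | a != s j) W j a by apply: sumr_ge0.
  move: h1; rewrite !ler_norml => /andP[h4 h5]; apply/andP; split; lra.
have s_inj : injective s.
  move=> i j ij; apply/eqP; apply: contraT => nij.
  have := col (s i); rewrite (bigD1 i)//= (bigD1 j) 1?eq_sym//=.
  have h1 := near1 i; have h2 := near1 j; rewrite -ij in h2.
  have h3 : 0 <= \sum_(a | (a != i) && (a != j)) W a (s i) by apply: sumr_ge0.
  by move: h1 h2; rewrite !ler_norml => /andP[h4 h5] /andP[h6 h7] /andP[h8 h9]; lra.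
exists (perm s_inj) => j; rewrite permE; split; first exact: near1.
by move=> b; exact: small.
Qed.

(** The signed permutation matrix that carries each entry [(j, s j)] of [G] to the
    diagonal and makes it nonnegative, multiplied by [G]. *)
Definition signed_perm p (s : {perm 'I_p}) (G : 'M[R]_p) : 'M[R]_p :=
  \matrix_(i, b) (Num.sg (G ((s^-1)%g i) i) * G ((s^-1)%g i) b).

Lemma row_signed_perm p (s : {perm 'I_p}) (G : 'M[R]_p) i :
  row i (signed_perm s G) = Num.sg (G ((s^-1)%g i) i) *: row ((s^-1)%g i) G.
Proof. by apply/rowP => b; rewrite !mxE. Qed.

(** Signs disappear in quadratic forms of the rows, and the objective is a sum over
    all rows. *)
Lemma argmax_signed_perm p k (M : 'M[R]_p) (N : 'I_k -> 'M[R]_p)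
    (s : {perm 'I_p}) (G : 'M[R]_p) :
  (forall j, G j (s j) != 0) ->
  argmax_set M N G -> argmax_set M N (signed_perm s G).
Proof.
move=> G0 [fG mG].
have sg2 i : Num.sg (G ((s^-1)%g i) i) * Num.sg (G ((s^-1)%g i) i) = 1.
  by rewrite -expr2 sqr_sg -{2}[i](permKV s) G0.
have formE i j (A : 'M[R]_p) :
   (row i (signed_perm s G) *m A *m (row j (signed_perm s G))^T) 0 0 =
   Num.sg (G ((s^-1)%g i) i) * Num.sg (G ((s^-1)%g j) j) *
   (row ((s^-1)%g i) G *m A *m (row ((s^-1)%g j) G)^T) 0 0.
  rewrite !row_signed_perm linearZ/= -scalemxAl -scalemxAl -scalemxAr scalerA.
  by rewrite mxE.
have entry (H A : 'M[R]_p) i j : (H *m A *m H^T) i j = (row i H *m A *m (row j H)^T) 0 0.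
  by rewrite -row_mul [LHS]mxE [RHS]mxE; apply: eq_bigr => q _; rewrite !mxE.
split; last first.
  move=> G' fG'; apply: le_trans (mG _ fG') _; rewrite le_eqVlt; apply/orP; left; apply/eqP.
  rewrite /objective; apply: eq_bigr => l _.
  rewrite (reindex_inj (@perm_inj _ (s^-1)%g)); apply: eq_bigr => j _.
  by rewrite formE sg2 mul1r.
apply/matrixP => i j; rewrite entry formE -entry fG !mxE.
rewrite (inj_eq perm_inj); have [->|_] := eqVneq i j; first by rewrite sg2 mul1r.
by rewrite mulr0.
Qed.

End SignedPermutation.

Section Consistency.
Context {R : realType}.

Lemma sqrB_le (q y a b : R) : `|q - y| <= a -> `|q| + `|y| <= b ->
  `|q ^+ 2 - y ^+ 2| <= a * b.
Proof.
move=> h1 h2; rewrite subr_sqr normrM; apply: ler_pM => //.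
exact: le_trans (ler_normD _ _) h2.
Qed.

Section Value.
Variables (p k : nat) (M G : 'M[R]_p) (N : 'I_k -> 'M[R]_p) (lam : 'I_k -> 'I_p -> R).
Variables (e C : R).
Hypotheses (e0 : 0 <= e) (ep : e * p%:R <= 2^-1) (C0 : 0 <= C).
Hypothesis Me : forall a b, `|M a b - (a == b)%:R| <= e.
Hypothesis Ne : forall l a b, `|N l a b - lam l a *+ (a == b)| <= e.
Hypothesis lamC : forall l a, `|lam l a| <= C.
Hypothesis GM : feasible M G.

Let y l j := \sum_a G j a ^+ 2 * lam l a.

Let y_le l j : `|y l j| <= 2 * C.
Proof.
apply: le_trans (ler_norm_sum _ _ _) _.
apply: (@le_trans _ _ (\sum_a G j a ^+ 2 * C)).
  apply: ler_sum => a _; rewrite normrM ger0_norm ?sqr_ge0//.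
  by rewrite ler_wpM2l// sqr_ge0.
by rewrite -mulr_suml ler_wpM2r//; apply: (feasible_row_le2 e0 ep Me GM).
Qed.

(** Each form of a row differs from the weighted mean by at most [2 * p%:R * e], and
    both are bounded by a multiple of [C]; so their squares are close as well. *)
Lemma objective_near :
  `|objective N G - \sum_l \sum_j (\sum_a G j a ^+ 2 * lam l a) ^+ 2| <=
  k%:R * p%:R * (2 * p%:R * e * (4 * C + 1)).
Proof.
rewrite /objective -sumrB; apply: le_trans (ler_norm_sum _ _ _) _.
rewrite -mulrA mulr_natl -[k in _ *+ k]card_ord -sumr_const; apply: ler_sum => l _.
rewrite -sumrB; apply: le_trans (ler_norm_sum _ _ _) _.
rewrite mulr_natl -[p in _ *+ p]card_ord -sumr_const; apply: ler_sum => j _.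
have h := row_form_near e0 ep Me GM j (Ne l).
apply: (sqrB_le h); rewrite -/(y l j).
set q : R := (_ *m _) 0 0 in h *; have h1 := y_le l j.
have h2 : `|q| <= `|q - y l j| + `|y l j| by rewrite -{1}[q](subrK (y l j)) ler_normD.
move: h h1 h2 (ep); rewrite -/(y l j).
move: (`|q - y l j|) (`|q|) (`|y l j|) => a b c h h1 h2 ep'; lra.
Qed.

Lemma objective_near1 (h : R) : h <= 1 ->
  (forall i j, `|G i j - (i == j)%:R| <= h) ->
  \sum_l \sum_a lam l a ^+ 2 - k%:R * p%:R * (9 * p%:R * C ^+ 2 * h) <=
  \sum_l \sum_j (\sum_a G j a ^+ 2 * lam l a) ^+ 2.
Proof.
move=> h1 Gh; rewrite lerBlDr -lerBlDl -sumrB; apply: le_trans (ler_norm _) _.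
apply: le_trans (ler_norm_sum _ _ _) _.
rewrite -mulrA mulr_natl -[k in _ *+ k]card_ord -sumr_const; apply: ler_sum => l _.
rewrite -sumrB; apply: le_trans (ler_norm_sum _ _ _) _.
rewrite mulr_natl -[p in _ *+ p]card_ord -sumr_const; apply: ler_sum => j _.
rewrite -/(y l j) (_ : _ * h = (p%:R * (3 * h * C)) * (3 * C)); last by ring.
apply: sqrB_le; last by have := y_le l j; have := lamC l j; lra.
have -> : lam l j - y l j = \sum_a ((j == a)%:R - G j a ^+ 2) * lam l a.
  have -> : lam l j = \sum_a (j == a)%:R * lam l a.
    rewrite (bigD1 j)//= eqxx mul1r big1 ?addr0// => a aj.
    by rewrite eq_sym (negbTE aj) mul0r.
  by rewrite -sumrB; apply: eq_bigr => a _; rewrite mulrBl.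
apply: le_trans (ler_norm_sum _ _ _) _.
rewrite mulr_natl -[p in _ *+ p]card_ord -sumr_const; apply: ler_sum => a _.
rewrite normrM; apply: ler_pM => //; rewrite distrC.
have -> : (j == a)%:R = (j == a)%:R ^+ 2 :> R by case: (j == a); rewrite ?expr1n ?expr0n.
rewrite (mulrC 3); apply: sqrB_le; first exact: Gh.
have d1 : `|(j == a)%:R| <= 1 :> R by case: (j == a); rewrite ?normr1 ?normr0.
have : `|G j a| <= `|G j a - (j == a)%:R| + `|(j == a)%:R|.
  by rewrite -{1}[G j a](subrK (j == a)%:R) ler_normD.
have := Gh j a; lra.
Qed.

End Value.

Let shrink (A B : R) : 0 <= A -> 0 < B ->
  exists2 t : R, 0 < t & forall u : R, 0 <= u <= t -> u * A <= B.
Proof.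
move=> A0 B0; exists (B / (A + 1)); first by rewrite divr_gt0// ltr_wpDl.
have A1 : 0 < A + 1 by rewrite ltr_wpDl.
move=> u /andP[u0]; rewrite ler_pdivlMr//; lra.
Qed.

(** A feasible matrix close to the identity almost reaches the upper bound
    [\sum_l \sum_a lam l a ^+ 2] of the diagonal problem, hence so does a maximizer,
    which must be nearly a signed permutation; undoing this signed permutation
    keeps it a maximizer and brings it next to the identity. *)
Lemma argmax_near_identity p k (C delta eta : R) :
  0 <= C -> 0 < delta -> 0 < eta ->
  exists2 e : R, 0 < e & forall (M : 'M[R]_p) (N : 'I_k -> 'M[R]_p) (lam : 'I_k -> 'I_p -> R),
    M^T = M ->
    (forall a b, `|M a b - (a == b)%:R| <= e) ->
    (forall l a b, `|N l a b - lam l a *+ (a == b)| <= e) ->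
    (forall l a, `|lam l a| <= C) ->
    (forall a b, a != b -> exists l, delta <= `|lam l a - lam l b|) ->
    forall G, argmax_set M N G ->
    exists2 G', argmax_set M N G' & forall i j, `|G' i j - (i == j)%:R| <= eta.
Proof.
move=> C0 d0 eta0.
have d20 : 0 < delta ^+ 2 by rewrite exprn_gt0.
have C20 : 0 <= C ^+ 2 by exact: sqr_ge0.
have pR0 : 0 <= p%:R :> R by exact: ler0n.
have p20 : 0 <= p%:R ^+ 2 :> R by exact: sqr_ge0.
have kp0 : 0 <= k%:R * p%:R :> R by rewrite mulr_ge0.
(* The tolerances are chosen backwards: [eta1] for the diagonal of [W], then [tau]
   for its row and column sums and for the loss of the objective, then [h] for the
   feasible matrix compared with the maximizer, and finally [e]. *)
pose K3 := (3 * (k%:R * p%:R * C ^+ 2) + 1) / delta ^+ 2.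
have K30 : 0 <= K3.
  by apply: divr_ge0 (ltW d20); apply: addr_ge0 => //; apply: mulr_ge0 => //; apply: mulr_ge0.
pose eta1 := Num.min (1 / 8) (eta / 2).
have eta10 : 0 < eta1 by rewrite lt_min !divr_gt0.
have [t1 t10 ht1] : exists2 t : R, 0 < t & forall u : R, 0 <= u <= t ->
    u * (2 * p%:R ^+ 2 * K3) <= eta1.
  by apply: shrink => //; apply: mulr_ge0 => //; apply: mulr_ge0.
have [t2 t20 ht2] : exists2 t : R, 0 < t & forall u : R, 0 <= u <= t ->
    u * (2 * p%:R * K3) <= Num.min (eta ^+ 2) (1/4).
  apply: shrink; last by rewrite lt_min exprn_gt0//= divr_gt0.
  by apply: mulr_ge0 => //; apply: mulr_ge0.
pose tau := Num.min eta1 (Num.min t1 t2).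
have tau0 : 0 < tau by rewrite lt_min eta10 lt_min t10 t20.
have tau_eta1 : tau <= eta1 by rewrite ge_min lexx.
have tau_t1 : 0 <= tau <= t1 by rewrite ltW//= /tau !ge_min lexx !orbT.
have tau_t2 : 0 <= tau <= t2 by rewrite ltW//= /tau !ge_min lexx !orbT.
have [h1 h10 hh1] : exists2 t : R, 0 < t & forall u : R, 0 <= u <= t ->
    u * (k%:R * p%:R * (9 * p%:R * C ^+ 2)) <= tau / 2.
  apply: shrink; last by rewrite divr_gt0.
  by apply: mulr_ge0 => //; apply: mulr_ge0 => //; apply: mulr_ge0.
pose h := Num.min 1 h1.
have h0 : 0 < h by rewrite lt_min ltr01.
have h_h1 : 0 <= h <= h1 by rewrite ltW//= ge_min lexx orbT.
have hle1 : h <= 1 by rewrite ge_min lexx.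
have [e1 e10 chol] := @posdef_whitening_near R p h h0.
have [e2 e20 he2] : exists2 t : R, 0 < t & forall u : R, 0 <= u <= t ->
    u * (2 * (k%:R * p%:R * (2 * p%:R * (4 * C + 1)))) <= tau / 2.
  apply: shrink; last by rewrite divr_gt0.
  apply: mulr_ge0 => //; apply: mulr_ge0 => //; apply: mulr_ge0; first exact: mulr_ge0.
  by apply: addr_ge0 => //; apply: mulr_ge0.
have [e3 e30 he3] : exists2 t : R, 0 < t & forall u : R, 0 <= u <= t -> u * p%:R <= 4^-1.
  by apply: shrink; rewrite // invr_gt0.
have [e4 e40 he4] : exists2 t : R, 0 < t & forall u : R, 0 <= u <= t ->
    u * (2 * p%:R ^+ 2 + 2 * p%:R) <= tau.
  by apply: shrink => //; apply: addr_ge0; apply: mulr_ge0.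
pose e := Num.min (Num.min e1 e2) (Num.min e3 e4).
have e0 : 0 < e by rewrite !lt_min e10 e20 e30 e40.
have e_e1 : e <= e1 by rewrite /e !ge_min lexx.
have {}he2 := he2 e ltac:(by rewrite ltW//= /e !ge_min lexx !orbT).
have {}he3 := he3 e ltac:(by rewrite ltW//= /e !ge_min lexx !orbT).
have {}he4 := he4 e ltac:(by rewrite ltW//= /e !ge_min lexx !orbT).
have e0' := ltW e0.
have ep : e * p%:R <= 2^-1 by apply: le_trans he3 _; rewrite lef_pV2 ?posrE// ler_nat.
exists e => // M N lam MT Me Ne lamC sep G [fG mG].
have Mpd : posdef M.
  apply: (posdef_near1 e0') => //; apply: le_lt_trans he3 _.
  by rewrite invf_lt1// ltr1n.
(* [G0] is the competitor that the maximizer [G] has to beat. *)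
have [G0 fG0 G0near] := chol M Mpd.
have {}G0near := G0near (fun a b => le_trans (Me a b) e_e1).
have o0 := objective_near e0' ep C0 Me Ne lamC fG0.
have o1 := objective_near1 e0' ep C0 Me lamC fG0 hle1 G0near.
have o2 := objective_near e0' ep C0 Me Ne lamC fG.
have oo := mG G0 fG0.
have {}hh1 := hh1 h h_h1.
pose W j a := G j a ^+ 2.
have W0 j a : 0 <= W j a by exact: sqr_ge0.
have obj : \sum_l \sum_a lam l a ^+ 2 - tau <= \sum_l \sum_j (\sum_a W j a * lam l a) ^+ 2.
  move: o0 o2; rewrite !ler_norml => /andP[q0 _] /andP[_ q2]; rewrite /W; lra.
have pe : 0 <= 2 * p%:R * e by apply: mulr_ge0 => //; apply: mulr_ge0.
have pe2 : 0 <= 2 * p%:R ^+ 2 * e by apply: mulr_ge0 => //; apply: mulr_ge0.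
have row j : `|\sum_a W j a - 1| <= tau.
  by apply: le_trans (feasible_row e0' ep Me fG j) _; lra.
have col a : `|\sum_j W j a - 1| <= tau.
  by apply: le_trans (feasible_col e0' ep Me fG a) _; lra.
have eta1_8 : eta1 <= 1 / 8 by rewrite ge_min lexx.
have eta1_eta : eta1 <= eta / 2 by rewrite ge_min lexx orbT.
pose kap := K3 * tau.
have kap0 : 0 <= kap by rewrite mulr_ge0// ltW.
have prod j a b : a != b -> W j a * W j b <= kap.
  move=> ab; have tau01 : 0 <= tau <= 1 by rewrite ltW//=; lra.
  have Hw := row_weights_product_le W0 tau01 (ltW d0) row col lamC sep obj j ab.
  by rewrite /kap /K3 [leRHS]mulrAC ler_pdivlMr.
have {}ht1 := ht1 tau tau_t1; have {}ht2 := ht2 tau tau_t2.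
have k1 : 2 * p%:R ^+ 2 * kap <= eta1 by rewrite /kap; lra.
have k2 : 2 * p%:R * kap <= eta ^+ 2.
  by apply: (@le_trans _ _ (tau * (2 * p%:R * K3))); [rewrite /kap; lra|apply: le_trans ht2 _; rewrite ge_min lexx].
have [s hs] := nearly_permutation W0 (le_trans tau_eta1 eta1_8) (le_trans k1 eta1_8) kap0 row col prod.
have Gs j : G j (s j) != 0.
  have [+ _] := hs j; rewrite /W; have [->|//] := eqVneq (G j (s j)) 0.
  by rewrite expr0n/= sub0r normrN normr1; lra.
exists (signed_perm s G); first by apply: argmax_signed_perm.
move=> i b; rewrite mxE; set j := (s^-1)%g i.
have ij : i = s j by rewrite permKV.
have [Wj Wb] := hs j; rewrite -ij in Wj Wb.
have [<-|ib] := eqVneq i b.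
  have -> : Num.sg (G j i) * G j i = `|G j i| by rewrite [RHS]normrEsg.
  have h2 : `| `|G j i| - 1| <= `|W j i - 1|.
    have -> : W j i - 1 = (`|G j i| - 1) * (`|G j i| + 1).
      by rewrite /W -real_normK ?num_real//; ring.
    rewrite normrM ler_peMr// ger0_norm ?addr_ge0// lerDr//.
  by apply: le_trans h2 _; lra.
rewrite subr0 normrM.
have h2 : `|G j b| <= eta.
  rewrite -(ler_pXn2r (n := 2))// ?nnegrE ?(ltW eta0)//.
  by rewrite real_normK ?num_real// (le_trans (Wb b _))// eq_sym.
apply: le_trans h2; rewrite ler_piMl// normr_sg; by case: (_ != _).
Qed.

End Consistency.

(** * Equivariance and Gram structure of the problem *)

Section Algebra.
Context {R : realType} {p k : nat}.
Implicit Types (Omega G M : 'M[R]_p) (N : 'I_k -> 'M[R]_p).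

Lemma row_congr Omega G M j :
  row j G *m (Omega *m M *m Omega^T) *m (row j G)^T =
  row j (G *m Omega) *m M *m (row j (G *m Omega))^T.
Proof. by rewrite row_mul trmx_mul !mulmxA. Qed.

Lemma feasible_congr Omega M G :
  feasible (Omega *m M *m Omega^T) G <-> feasible M (G *m Omega).
Proof. by rewrite /feasible trmx_mul !mulmxA. Qed.

Lemma objective_congr Omega N G :
  objective (fun l => Omega *m N l *m Omega^T) G = objective N (G *m Omega).
Proof.
by apply: eq_bigr => l _; apply: eq_bigr => j _; rewrite row_congr.
Qed.

(** The row [j] of [G] gives on [Omega *m N *m Omega^T] the same forms as the row
    [j] of [G *m Omega] on [N]; as [Omega] is invertible, [G *m Omega] ranges over
    all matrices. *)
Lemma argmax_congr Omega M N G : Omega \in unitmx ->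
  argmax_set (Omega *m M *m Omega^T) (fun l => Omega *m N l *m Omega^T) G <->
  argmax_set M N (G *m Omega).
Proof.
move=> Ou; rewrite /argmax_set /= feasible_congr objective_congr.
split=> -[fG mG]; split => // G' fG'.
  have := mG (G' *m invmx Omega); rewrite feasible_congr objective_congr.
  by rewrite mulmxKV//; apply.
by rewrite objective_congr; apply: mG; apply/feasible_congr.
Qed.

Lemma feasible_unit M G : feasible M G -> M \in unitmx.
Proof.
by move=> /mulmx1_unit[]; rewrite unitmx_mul => /andP[].
Qed.

(** The trace of [G^T *m G = invmx M] is the sum of the squared entries of [G]. This
    makes the feasible set bounded. *)
Lemma feasible_entry_le M G i j : feasible M G -> G i j ^+ 2 <= \tr (invmx M).
Proof.
move=> fG; have Mu := feasible_unit fG.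
have E : G^T *m G = invmx M.
  have h : G^T *m G *m M = 1%:M.
    by rewrite -mulmxA; apply: mulmx1C; exact: fG.
  by rewrite -[LHS](mulmxK Mu) h mul1mx.
rewrite -E /mxtrace (bigD1 j)//= mxE (bigD1 i)//= !mxE -expr2 -addrA lerDl.
apply: addr_ge0; apply: sumr_ge0 => a _.
  by rewrite !mxE -expr2 sqr_ge0.
by rewrite mxE; apply: sumr_ge0 => b _; rewrite !mxE -expr2 sqr_ge0.
Qed.

End Algebra.

Section Fields.
Context {T : Type} {R : realType} {d p : nat}.
Variables (Omega : 'M[R]_p) (Z : 'I_p -> 'cV[R]_d -> T -> R).

Definition latent_field (x : 'cV[R]_d) (w : T) : 'cV[R]_p := \col_r Z r x w.

Lemma MhatE n (X : 'cV[R]_d -> T -> 'cV[R]_p) (s : 'I_n -> 'cV[R]_d) g w r q :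
  Mhat X s g w r q =
  n%:R^-1 * \sum_i \sum_j g (s i - s j) * (X (s i) w r 0 * X (s j) w q 0).
Proof.
rewrite /Mhat mxE summxE; congr (_ * _); apply: eq_bigr => i _.
rewrite summxE; apply: eq_bigr => j _.
by rewrite !mxE big_ord1 !mxE.
Qed.

Lemma Mhat_latentE n (s : 'I_n -> 'cV[R]_d) g w r q :
  Mhat latent_field s g w r q =
  n%:R^-1 * \sum_i \sum_j g (s i - s j) * (Z r (s i) w * Z q (s j) w).
Proof.
rewrite MhatE; congr (_ * _); apply: eq_bigr => i _; apply: eq_bigr => j _.
by rewrite !mxE.
Qed.

Lemma Mhat_observed n (s : 'I_n -> 'cV[R]_d) g w :
  Mhat (observed_field Omega Z) s g w = Omega *m Mhat latent_field s g w *m Omega^T.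
Proof.
rewrite /Mhat -scalemxAr -scalemxAl; congr (_ *: _).
rewrite mulmx_sumr mulmx_suml; apply: eq_bigr => i _.
rewrite mulmx_sumr mulmx_suml; apply: eq_bigr => j _.
by rewrite -scalemxAr -scalemxAl /observed_field trmx_mul !mulmxA.
Qed.

Lemma f0_points n (s : 'I_n -> 'cV[R]_d) i j : injective s ->
  f0 (s i - s j) = (i == j)%:R :> R.
Proof. by move=> si; rewrite /f0 subr_eq0 (inj_eq si). Qed.

Lemma Mhat_f0_gram n (X : 'cV[R]_d -> T -> 'cV[R]_p) (s : 'I_n -> 'cV[R]_d) w :
  injective s ->
  Mhat X s f0 w = n%:R^-1 *: \sum_i (X (s i) w *m (X (s i) w)^T).
Proof.
move=> si; rewrite /Mhat; congr (_ *: _); apply: eq_bigr => i _.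
rewrite (bigD1 i)//= f0_points// eqxx scale1r big1 ?addr0// => j ji.
by rewrite f0_points// eq_sym (negbTE ji) scale0r.
Qed.

Lemma Mhat_f0_sym n (X : 'cV[R]_d -> T -> 'cV[R]_p) (s : 'I_n -> 'cV[R]_d) w :
  injective s -> (Mhat X s f0 w)^T = Mhat X s f0 w.
Proof.
move=> si; rewrite Mhat_f0_gram// linearZ/= linear_sum/=; congr (_ *: _).
by apply: eq_bigr => i _; rewrite trmx_mul trmxK.
Qed.

(** A vector annihilated by the form of a Gram matrix is orthogonal to every sample,
    hence belongs to the kernel of the matrix. *)
Lemma Mhat_f0_posdef n (X : 'cV[R]_d -> T -> 'cV[R]_p) (s : 'I_n -> 'cV[R]_d) w :
  injective s -> Mhat X s f0 w \in unitmx -> posdef (Mhat X s f0 w).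
Proof.
move=> si Mu; split; first exact: Mhat_f0_sym.
have E := Mhat_f0_gram X w si.
move=> x x0.
have qE : (x *m Mhat X s f0 w *m x^T) 0 0 =
    n%:R^-1 * \sum_i ((x *m X (s i) w) 0 0) ^+ 2.
  rewrite E -scalemxAr -scalemxAl mxE; congr (_ * _).
  rewrite mulmx_sumr mulmx_suml summxE; apply: eq_bigr => i _.
  rewrite !mulmxA -[_ *m _ *m x^T]mulmxA -trmx_mul mxE big_ord1.
  by rewrite [((x *m _)^T) 0 0]mxE expr2.
rewrite qE lt_neqAle; apply/andP; split; last first.
  by rewrite mulr_ge0 ?invr_ge0// sumr_ge0// => i _; exact: sqr_ge0.
apply: contra_neq x0 => /esym/eqP; rewrite mulf_eq0 => /orP h.
have xM0 : x *m Mhat X s f0 w = 0.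
  case: h => [/eqP n0|]; first by rewrite E n0 scale0r mulmx0.
  rewrite psumr_eq0 => [/allP h|i _]; last exact: sqr_ge0.
  rewrite E -scalemxAr mulmx_sumr big1 ?scaler0// => i _.
  have := h i (mem_index_enum _); rewrite /= sqrf_eq0 => /eqP xi.
  by rewrite mulmxA [x *m _]mx11_scalar xi -scalemx1 scale0r mul0mx.
by rewrite -[x](mulmxK Mu) xM0 mul0mx.
Qed.

End Fields.

(** * Random choice of a maximizer *)

Section Caratheodory.
Context {dT : measure_display} {T : measurableType dT} {R : realType} {N : nat}.
Implicit Types (h phi : T -> 'rV[R]_N -> R).

Lemma caratheodory_fun (f : T -> R) : measurable_fun setT f ->
  @caratheodory _ T R N (fun w _ => f w).
Proof.
by move=> mf; split => // w v; apply: cvg_cst; exact: nbhs_filter.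
Qed.

Lemma caratheodoryD h phi : caratheodory h -> caratheodory phi ->
  caratheodory (fun w v => h w v + phi w v).
Proof.
move=> [mh ch] [mphi cphi]; split=> [v|w v]; first exact: measurable_funD.
by apply: cvgD; [exact: nbhs_filter|exact: ch|exact: cphi].
Qed.

Lemma caratheodoryM h phi : caratheodory h -> caratheodory phi ->
  caratheodory (fun w v => h w v * phi w v).
Proof.
move=> [mh ch] [mphi cphi]; split=> [v|w v]; first exact: measurable_funM.
by apply: cvgM; [exact: nbhs_filter|exact: ch|exact: cphi].
Qed.

Lemma eq_caratheodory h phi : (forall w v, h w v = phi w v) ->
  caratheodory h -> caratheodory phi.
Proof. by move=> e; have -> : h = phi by apply/funext => w; apply/funext => v. Qed.

Lemma caratheodory_sum (I : Type) (r : seq I) (F : I -> T -> 'rV[R]_N -> R) :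
  (forall i, caratheodory (F i)) -> caratheodory (fun w v => \sum_(i <- r) F i w v).
Proof.
move=> cF; elim: r => [|i r IH].
  apply: eq_caratheodory (caratheodory_fun (f := fun=> 0) _) => //.
  by move=> w v; rewrite big_nil.
by apply: eq_caratheodory (caratheodoryD (cF i) IH) => w v; rewrite big_cons.
Qed.

Lemma caratheodoryX2 h : caratheodory h -> caratheodory (fun w v => h w v ^+ 2).
Proof.
by move=> ch; apply: eq_caratheodory (caratheodoryM ch ch) => w v; rewrite expr2.
Qed.

Definition caratheodory_mx m n (A : T -> 'rV[R]_N -> 'M[R]_(m, n)) :=
  forall i j, caratheodory (fun w v => A w v i j).

Lemma caratheodory_mulmx m n q (A : T -> 'rV[R]_N -> 'M[R]_(m, n))
    (B : T -> 'rV[R]_N -> 'M[R]_(n, q)) :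
  caratheodory_mx A -> caratheodory_mx B -> caratheodory_mx (fun w v => A w v *m B w v).
Proof.
move=> cA cB i j; apply: eq_caratheodory (caratheodory_sum (index_enum _)
  (fun l => caratheodoryM (cA i l) (cB l j))) => w v.
by rewrite mxE.
Qed.

Lemma caratheodory_trmx m n (A : T -> 'rV[R]_N -> 'M[R]_(m, n)) :
  caratheodory_mx A -> caratheodory_mx (fun w v => (A w v)^T).
Proof. by move=> cA i j; apply: eq_caratheodory (cA j i) => w v; rewrite mxE. Qed.

Lemma caratheodory_row m n (A : T -> 'rV[R]_N -> 'M[R]_(m, n)) l :
  caratheodory_mx A -> caratheodory_mx (fun w v => row l (A w v)).
Proof. by move=> cA i j; apply: eq_caratheodory (cA l j) => w v; rewrite mxE. Qed.

Lemma caratheodory_random m n (A : T -> 'M[R]_(m, n)) :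
  random_matrix A -> caratheodory_mx (fun w _ => A w).
Proof. by move=> mA i j; exact: caratheodory_fun. Qed.

End Caratheodory.

Section ArgmaxSelection.
Context {dT : measure_display} {T : measurableType dT} {R : realType} {p k : nat}.
Variables (M0 : T -> 'M[R]_p) (M : 'I_k -> T -> 'M[R]_p) (L : 'M[R]_p).
Hypothesis M0_meas : random_matrix M0.
Hypothesis M_meas : forall l, random_matrix (M l).
Hypothesis M0_pd : forall w, M0 w \in unitmx -> posdef (M0 w).

Let V := 'rV[R]_(p * p).

Let caratheodory_vec_mx : caratheodory_mx (fun (_ : T) (v : V) => vec_mx v : 'M[R]_p).
Proof.
move=> i j; apply: eq_caratheodory (caratheodory_coord (mxvec_index i j)) => w v.
by rewrite mxE.
Qed.

(* Feasibility as a sublevel set: a sum of squares is nonpositive iff it is zero. *)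
Let residual (w : T) (v : V) :=
  \sum_i \sum_j ((vec_mx v *m M0 w *m (vec_mx v)^T) i j - (i == j)%:R) ^+ 2.

Let residual_caratheodory : caratheodory residual.
Proof.
apply: caratheodory_sum => i; apply: caratheodory_sum => j; apply: caratheodoryX2.
apply: caratheodoryD; last by apply: caratheodory_fun; exact: measurable_cst.
apply: caratheodory_mulmx; last exact: caratheodory_trmx.
by apply: caratheodory_mulmx => //; exact: caratheodory_random.
Qed.

Let residual_le0 w v : residual w v <= 0 <-> feasible (M0 w) (vec_mx v).
Proof.
split; last first.
  move=> fv; rewrite /residual fv big1// => i _; rewrite big1// => j _.
  by rewrite mxE subrr expr0n.
move=> r0; have : residual w v == 0.
  rewrite eq_le r0 sumr_ge0// => i _; apply: sumr_ge0 => j _; exact: sqr_ge0.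
rewrite psumr_eq0 => [/allP h|i _]; last by apply: sumr_ge0 => j _; exact: sqr_ge0.
apply/matrixP => i j; rewrite [RHS]mxE; apply/eqP; rewrite -subr_eq0.
have := h i (mem_index_enum _); rewrite /= psumr_eq0 => [/allP h'|j' _]; last exact: sqr_ge0.
by have := h' j (mem_index_enum _); rewrite /= sqrf_eq0.
Qed.

Let feas (w : T) : set V := [set v | residual w v <= 0].

Let feas_compact w : compact (feas w).
Proof.
have [_ cr] := residual_caratheodory.
apply: bounded_closed_compact; last exact: closed_le0 (cr w).
pose B := 1 + `|\tr (invmx (M0 w))|.
exists B; split; first exact: num_real.
move=> x Bx v /residual_le0 fv; rewrite /Num.norm/= mx_normrE.
have x0 : 0 <= x by apply: le_trans (ltW Bx); rewrite addr_ge0.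
apply/bigmax_leP; split => // -[i' i] _ /=; rewrite ord1 {i'}.
apply: le_trans (ltW Bx); case/mxvec_indexP: i => i j.
have h := feasible_entry_le i j fv; rewrite mxE in h.
have {}h := le_trans h (ler_norm _).
rewrite -(real_normK (num_real _)) in h.
move: h; rewrite /B; move: `|v 0 _| (normr_ge0 (v 0 (mxvec_index i j))) => a a0 h.
by nra.
Qed.

Let sqdist (w : T) (v : V) := \sum_i \sum_j (vec_mx v i j - L i j) ^+ 2.

Let sqdist_caratheodory : caratheodory sqdist.
Proof.
apply: caratheodory_sum => i; apply: caratheodory_sum => j; apply: caratheodoryX2.
apply: caratheodoryD; last by apply: caratheodory_fun; exact: measurable_cst.
exact: caratheodory_vec_mx.
Qed.

Let loss (w : T) (v : V) := -1 * objective (fun l => M l w) (vec_mx v).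

Let loss_caratheodory : caratheodory loss.
Proof.
apply: caratheodoryM; first by apply: caratheodory_fun; exact: measurable_cst.
apply: caratheodory_sum => l; apply: caratheodory_sum => j; apply: caratheodoryX2.
have cr : caratheodory_mx (fun (_ : T) (v : V) => row j (vec_mx v : 'M[R]_p)).
  exact: caratheodory_row.
apply: caratheodory_mulmx; last exact: caratheodory_trmx.
by apply: caratheodory_mulmx => //; exact: caratheodory_random.
Qed.

(** Among the maximizers the selection takes one at minimal distance from [L],
    which settles the indeterminacy by signed permutations. *)
Lemma argmax_selection : exists2 Gam : T -> 'M[R]_p,
  random_matrix Gam & forall w, M0 w \in unitmx ->
    [/\ argmax_set (M0 w) (fun l => M l w) (Gam w) &
      forall G : 'M[R]_p, argmax_set (M0 w) (fun l => M l w) G ->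
      \sum_i \sum_j (Gam w i j - L i j) ^+ 2 <=
      \sum_i \sum_j (G i j - L i j) ^+ 2].
Proof.
pose C1 := argmin loss feas; pose C2 := argmin sqdist C1.
have c1 w : compact (C1 w) by apply: compact_argmin => //; exact: (proj2 loss_caratheodory).
have m1 : measurable_corr C1.
  by apply: measurable_argmin => //; exact: measurable_corr_le0.
have c2 w : compact (C2 w) by apply: compact_argmin => //; exact: (proj2 sqdist_caratheodory).
have m2 : measurable_corr C2 by apply: measurable_argmin.
have C1E w v : C1 w v <-> argmax_set (M0 w) (fun l => M l w) (vec_mx v).
  split=> -[fv mv]; split.
  - exact/residual_le0.
  - move=> G' fG'; have /= := mv (mxvec G'); rewrite /loss mxvecK !mulN1r lerN2; apply.
    by apply/residual_le0; rewrite mxvecK.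
  - exact/residual_le0.
  - by move=> u /residual_le0 fu; rewrite /loss !mulN1r lerN2; exact: mv.
have [v [mv vC]] := measurable_selection c2 m2.
exists (fun w => vec_mx (v w)).
  by move=> i j; under eq_fun do rewrite mxE; exact: mv.
move=> w Mu.
have [eps _ /(_ _ (M0_pd Mu))[G fG _]] := @posdef_whitening_near R p 1 ltr01.
have ne : C2 w !=set0.
  apply: argmin_nonempty => //; first exact: (proj2 sqdist_caratheodory).
  apply: argmin_nonempty => //; first exact: (proj2 loss_caratheodory).
  by exists (mxvec G); apply/residual_le0; rewrite mxvecK.
have [Cv dv] := vC _ ne; split; first exact/C1E.
move=> G' aG'; have := dv (mxvec G'); rewrite /sqdist mxvecK; apply.
by apply/C1E; rewrite mxvecK.
Qed.

End ArgmaxSelection.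

(** * Concentration of the latent moment matrices *)

Section LatentMoments.
Context {R : realType} {dT : measure_display} {T : measurableType dT}.
Variables (P : probability T R) (d p : nat).
Variables (Z : 'I_p -> 'cV[R]_d -> {RV P >-> R}) (K : 'I_p -> 'cV[R]_d -> R).
Hypothesis Z_indep : independent_processes P Z.
Hypothesis Z_gauss : forall r, gaussian_process P (Z r).
Hypothesis Z_mean : forall r x, ('E_P[Z r x] = 0)%E.
Hypothesis Z_var : forall r x, ('V_P[Z r x] = 1)%E.
Hypothesis Z_cov : forall r, stationary_covariance P (Z r) (K r).

(* The random variables as mere functions, which is what [Mhat] takes. *)
Let Zf (r : 'I_p) (x : 'cV[R]_d) (w : T) : R := Z r x w.

Lemma covariance0 r : K r 0 = 1.
Proof.
have := Z_cov r 0 0; rewrite subrr.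
by have := Z_var r 0; rewrite /variance => -> [].
Qed.

Section Sample.
Variables (n : nat) (s : 'I_n -> 'cV[R]_d) (g : 'cV[R]_d -> R).

Definition mean_form (r : 'I_p) : R :=
  n%:R^-1 * \sum_i \sum_j g (s i - s j) * K r (s i - s j).

Lemma has_integral_Mhat_latent r q :
  has_integral P setT (fun w => Mhat (latent_field Zf) s g w r q)
    (mean_form r *+ (r == q)).
Proof.
have h := has_integralZ n%:R^-1 (has_integral_sum (index_enum _)
    (P := fun=> true) measurableT (fun i _ => has_integral_sum (index_enum _)
      (P := fun=> true) measurableT (fun j _ => has_integralZ (g (s i - s j))
        (latent_moment2 Z_indep Z_gauss Z_mean Z_cov r q (s i) (s j))))).
apply: eq_has_integral h => [w|]; first by rewrite Mhat_latentE.
rewrite /mean_form; case: (r == q); rewrite /= ?mulr1n ?mulr0n.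
  by congr (_ * _); apply: eq_bigr => i _; apply: eq_bigr => j _; rewrite mul1r.
by rewrite big1 ?mulr0// => i _; rewrite big1// => j _; rewrite mul0r mulr0.
Qed.

Lemma expect_Mhat_observed (Omega : 'M[R]_p) :
  expect_mx P (Mhat (observed_field Omega Zf) s g) =
  Omega *m (\matrix_(r, q) (mean_form r *+ (r == q))) *m Omega^T.
Proof.
apply/matrixP => i j; rewrite mxE.
have h := has_integral_sum (index_enum _) (P := fun=> true) measurableT
  (fun b _ => has_integralZ (Omega j b)
    (has_integral_sum (index_enum _) (P := fun=> true) measurableT
      (fun a _ => has_integralZ (Omega i a) (has_integral_Mhat_latent a b)))).
rewrite [X in fine X](has_integral_expectation (c :=
  (Omega *m (\matrix_(r, q) (mean_form r *+ (r == q))) *m Omega^T) i j))//.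
apply: eq_has_integral h => [w|].
  rewrite Mhat_observed [RHS]mxE; apply: eq_bigr => b _.
  by rewrite [(_ *m _) i b]mxE [(Omega^T) _ _]mxE mulrC.
rewrite [RHS]mxE; apply: eq_bigr => b _.
rewrite [(_ *m _) i b]mxE [(Omega^T) _ _]mxE mulrC; congr (_ * _).
by apply: eq_bigr => a _; rewrite !mxE.
Qed.

Lemma random_Mhat_latent : random_matrix (Mhat (latent_field Zf) s g).
Proof.
move=> r q; under eq_fun do rewrite Mhat_latentE.
apply: measurable_funM => //.
apply: measurable_sum => i; apply: measurable_sum => j.
by apply: measurable_funM => //; exact: measurable_funM.
Qed.

Lemma random_Mhat_observed (Omega : 'M[R]_p) :
  random_matrix (Mhat (observed_field Omega Zf) s g).
Proof.
move=> i j; under eq_fun do rewrite Mhat_observed mxE.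
apply: measurable_sum => b; apply: measurable_funM => //.
under eq_fun do rewrite mxE.
by apply: measurable_sum => a; apply: measurable_funM => //; exact: random_Mhat_latent.
Qed.

Variables (kap : 'I_n -> 'I_n -> R) (C : R).
Hypothesis kap_sym : forall i j, kap i j = kap j i.
Hypothesis kap_sum : forall i, \sum_j kap i j <= C.
Hypothesis K_kap : forall r i j, `|K r (s i - s j)| <= kap i j.
Hypothesis g_kap : forall i j, `|g (s i - s j)| <= kap i j.

Lemma Mhat_latent_deviation r q (e : R) : 0 < e ->
  (P [set w | (e <= `|Mhat (latent_field Zf) s g w r q - mean_form r *+ (r == q)|)%R]
   <= (2 * C ^+ 4 / n%:R / e ^+ 2)%:E)%E.
Proof.
move=> e0.
have [v hv vle] := quadratic_form_variance Z_indep Z_gauss Z_mean Z_cov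
  kap_sym kap_sum K_kap g_kap r q.
have mE : n%:R^-1 * (\sum_i \sum_j g (s i - s j) * ((r == q)%:R * K r (s i - s j))) =
    mean_form r *+ (r == q).
  rewrite /mean_form; case: (r == q); rewrite /= ?mulr1n ?mulr0n.
    by congr (_ * _); apply: eq_bigr => i _; apply: eq_bigr => j _; rewrite mul1r.
  by rewrite big1 ?mulr0// => i _; rewrite big1// => j _; rewrite mul0r mulr0.
apply: (@le_trans _ _ (v / e ^+ 2)%:E).
  apply: has_integral_chebyshev => //.
    by apply: measurable_funB => //; exact: random_Mhat_latent.
  by apply: eq_has_integral hv => [w|//]; rewrite Mhat_latentE mE.
by rewrite lee_fin ler_wpM2r// invr_ge0 sqr_ge0.
Qed.

(** One factor [C] bounds the weight [g], the other one the row sums of [K]. *)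
Lemma mean_form_le r : `|mean_form r| <= C ^+ 2.
Proof.
have kap0 i j : 0 <= kap i j by apply: le_trans (g_kap i j).
have [n0|n0] := posnP n.
  have nz : n%:R = 0 :> R by rewrite n0.
  by rewrite /mean_form nz invr0 mul0r normr0 sqr_ge0.
have kle i j : kap i j <= C.
  by apply: le_trans (kap_sum i); rewrite (bigD1 j)//= lerDl sumr_ge0.
have C0 : 0 <= C by apply: le_trans (kle (Ordinal n0) (Ordinal n0)).
have nR : 0 < n%:R :> R by rewrite ltr0n.
rewrite /mean_form normrM gtr0_norm ?invr_gt0// mulrC ler_pdivrMr//.
apply: le_trans (ler_norm_sum _ _ _) _.
rewrite mulr_natr -[n in _ *+ n]card_ord -sumr_const; apply: ler_sum => i _.
apply: le_trans (ler_norm_sum _ _ _) _.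
apply: (@le_trans _ _ (\sum_j C * kap i j)).
  apply: ler_sum => j _; rewrite normrM; apply: ler_pM => //.
  exact: le_trans (g_kap i j) (kle i j).
by rewrite -mulr_sumr expr2 ler_wpM2l.
Qed.

End Sample.

End LatentMoments.

(** * Consistency of the estimator *)

Lemma union_bound {dT : measure_display} {T : measurableType dT} {R : realType}
    (P : probability T R) (I : finType) (A : I -> set T) (X : set T) (c : R) :
  (forall i, measurable (A i)) -> measurable X ->
  (forall w, X w -> exists i, A i w) -> (forall i, (P (A i) <= c%:E)%E) ->
  (P X <= (#|I|%:R * c)%:E)%E.
Proof.
move=> mA mX XA Pc.
have U (r : seq I) : measurable (\big[setU/set0]_(i <- r) A i) /\
    (P (\big[setU/set0]_(i <- r) A i) <= ((size r)%:R * c)%:E)%E.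
  elim: r => [|i r [mU PU]]; first by rewrite big_nil measure0 mul0r.
  rewrite big_cons; split; first exact: measurableU.
  apply: le_trans (measureU2 _ _ _) _ => //.
  by rewrite /= -natr1 mulrDl mul1r EFinD [leRHS]addeC leeD.
have [mU PU] := U (enum I); rewrite cardE.
apply: le_trans PU; apply: le_measure; rewrite ?inE//.
move=> w /XA[i Aiw]; rewrite -bigcup_seq; exists i => //=.
by rewrite mem_enum.
Qed.

Unset Implicit Arguments.

Theorem proposition6 (R : realType) (dT : measure_display)
  (T : measurableType dT) (P : probability T R)
  (d p k : nat) (d_ge1 : (1 <= d)%N) (p_ge1 : (1 <= p)%N)
  (S : set 'cV[R]_d) (s : forall n : nat, 'I_n -> 'cV[R]_d)
  (s_in : forall (n : nat) (i : 'I_n), S (s n i))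
  (Z : 'I_p -> 'cV[R]_d -> {RV P >-> R})
  (K : 'I_p -> 'cV[R]_d -> R)
  (Omega : 'M[R]_p) (Omega_inv : Omega \in unitmx)
  (f : 'I_k -> 'cV[R]_d -> R)
  (Delta A alpha delta : R) (n0 : nat)
  (Z_indep : independent_processes P Z)
  (Z_gauss : forall r, gaussian_process P (Z r))
  (Z_mean : forall r x, ('E_P[Z r x] = 0)%E)
  (Z_var : forall r x, ('V_P[Z r x] = 1)%E)
  (Z_cov : forall r, stationary_covariance P (Z r) (K r))
  (Delta_gt0 : 0 < Delta)
  (s_sep : forall (n : nat) (i j : 'I_n), i != j ->
     Delta <= enorm (s n i - s n j))
  (A_gt0 : 0 < A) (alpha_gt0 : 0 < alpha)
  (K_decay : forall r x, `|K r x| <= A / (1 + enorm x `^ (d%:R + alpha)))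
  (f_decay : forall l x, `|f l x| <= A / (1 + enorm x `^ (d%:R + alpha)))
  (delta_gt0 : 0 < delta)
  (identif : forall n : nat, (n0 <= n)%N -> forall i j : 'I_p, i != j ->
     exists l : 'I_k,
       let M := expect_mx P (Mhat (observed_field Omega Z) (s n) (f l)) in
       let D := invmx Omega *m M *m invmx (Omega^T) in
       delta <= `|D i i - D j j|) :
  exists Gamma : nat -> T -> 'M[R]_p,
    [/\ forall n, random_matrix (Gamma n),
        forall n w,
          let M_ g := Mhat (observed_field Omega Z) (s n) g w in
          M_ f0 \in unitmx ->
          argmax_set (M_ f0) (fun l => M_ (f l)) (Gamma n w)
      & cvg_in_probability P Gamma (invmx Omega)].
Proof.
(* [kap] dominates the covariances and the weights alike, [f0] included. *)
have [C HC] := separated_decay_sum d_ge1 Delta_gt0 A_gt0 alpha_gt0.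
pose kap n (i j : 'I_n) : R := A / (1 + enorm (s n i - s n j) `^ (d%:R + alpha)).
have kap_sym n i j : kap n i j = kap n j i by rewrite /kap -enormN opprB.
have kap_sum n i : \sum_j kap n i j <= C := HC n (s n) (s_sep n) i.
have K_kap n r i j : `|K r (s n i - s n j)| <= kap n i j by exact: K_decay.
have f_kap n l i j : `|f l (s n i - s n j)| <= kap n i j by exact: f_decay.
have s_inj n : injective (s n).
  move=> i j ij; apply/eqP; apply: contraT => /s_sep; rewrite ij subrr leNgt.
  have -> : enorm (0 : 'cV[R]_d) = 0.
    by rewrite /enorm big1 ?sqrtr0// => a _; rewrite big1// => b _; rewrite mxE expr0n.
  by rewrite Delta_gt0.
have K0 r : K r 0 = 1 by exact: (covariance0 Z_var Z_cov).
have f0_kap n i j : `|f0 (s n i - s n j) : R| <= kap n i j.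
  rewrite f0_points//; have [<-|_] := eqVneq i j.
    by have := K_kap n (Ordinal p_ge1) i i; rewrite subrr K0 normr1.
  by rewrite normr0 divr_ge0 ?(ltW A_gt0)// addr_ge0// powR_ge0.
(* [M_] is observed, [N_] is latent. *)
pose X := observed_field Omega Z.
pose Lt := latent_field Z.
pose M_ n g w := Mhat X (s n) g w.
pose N_ n g w := Mhat Lt (s n) g w.
have MN n g w : M_ n g w = Omega *m N_ n g w *m Omega^T by exact: Mhat_observed.
have selection n : exists Gam : T -> 'M[R]_p, random_matrix Gam /\
    forall w, M_ n f0 w \in unitmx ->
    [/\ argmax_set (M_ n f0 w) (fun l => M_ n (f l) w) (Gam w) &
      forall G : 'M[R]_p, argmax_set (M_ n f0 w) (fun l => M_ n (f l) w) G ->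
      \sum_i \sum_j (Gam w i j - (invmx Omega) i j) ^+ 2 <=
      \sum_i \sum_j (G i j - (invmx Omega) i j) ^+ 2].
  have [Gam m h] := argmax_selection (invmx Omega)
    (random_Mhat_observed Z (s n) f0 Omega)
    (fun l => random_Mhat_observed Z (s n) (f l) Omega)
    (fun w => Mhat_f0_posdef (X := X) (w := w) (@s_inj n)).
  by exists Gam.
have [Gam HGam] := choice selection.
exists Gam; split.
- by move=> n; case: (HGam n).
- by move=> n w /= Mu; case: (HGam n) => _ /(_ w Mu)[].
move=> eps eps0.
(* [eta] is such that multiplication by [invmx Omega] turns entrywise errors [eta]
   into an error [eps]. *)
pose B : R := \sum_a \sum_b `|(invmx Omega) a b|.
have B0 : 0 <= B by apply: sumr_ge0 => a _; apply: sumr_ge0.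
have pB0 : 0 < p%:R * B + 1 by rewrite ltr_wpDl// mulr_ge0.
pose eta : R := eps / (p%:R * B + 1).
have eta0 : 0 < eta by rewrite divr_gt0.
have [e' e'0 near_id] := @argmax_near_identity R p k (C ^+ 2) delta eta (sqr_ge0 _) delta_gt0 eta0.
(* The second bound makes [N_ n f0] positive definite on the good event. *)
pose e : R := Num.min e' (4 * (p%:R + 1))^-1.
have p10 : 0 < p%:R + 1 :> R by rewrite ltr_wpDl.
have e0 : 0 < e by rewrite lt_min e'0 invr_gt0 mulr_gt0.
have ee' : e <= e' by rewrite ge_min lexx.
have ep : e * p%:R < 1.
  have : e <= (4 * (p%:R + 1))^-1 by rewrite ge_min lexx orbT.
  rewrite -(ler_pM2r (x := 4 * (p%:R + 1))) ?mulr_gt0// mulVf ?gt_eqF ?mulr_gt0//.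
  have := ler0n R p; nra.
pose bad n (a b : 'I_p) : set T := [set w | (e <= `|N_ n f0 w a b - (a == b)%:R|)%R].
pose badl n (l : 'I_k) (a b : 'I_p) : set T :=
  [set w | (e <= `|N_ n (f l) w a b - mean_form K (s n) (f l) a *+ (a == b)|)%R].
pose bound n : R := 2 * C ^+ 4 / n%:R / e ^+ 2.
have Pbad n a b : (0 < n)%N -> (P (bad n a b) <= (bound n)%:E)%E.
  move=> n_gt0; have := Mhat_latent_deviation Z_indep Z_gauss Z_mean Z_cov (kap_sym n)
    (kap_sum n) (fun r i j => K_kap n r i j) (f0_kap n) a b e0.
  rewrite (_ : mean_form K (s n) f0 a = 1)//.
  rewrite /mean_form (eq_bigr (fun=> 1)) => [|i _].
    by rewrite sumr_const card_ord mulVf// pnatr_eq0 -lt0n.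
  rewrite (bigD1 i)//= subrr K0 mulr1 big1 ?addr0 => [|j ji].
    by rewrite /f0 eqxx.
  by rewrite f0_points// eq_sym (negbTE ji) mul0r.
have Pbadl n l a b : (P (badl n l a b) <= (bound n)%:E)%E.
  exact: (Mhat_latent_deviation Z_indep Z_gauss Z_mean Z_cov (kap_sym n)
    (kap_sum n) (fun r i j => K_kap n r i j) (f_kap n l) a b e0).
(* Outside of the bad events the estimator is close to [invmx Omega]. *)
have good n w : (n0 <= n)%N -> (0 < n)%N ->
    (forall a b, ~ bad n a b w) -> (forall l a b, ~ badl n l a b w) ->
    enorm (Gam n w - invmx Omega) <= eps.
  move=> n0n n_gt0 nb nbl.
  have nb' a b : `|N_ n f0 w a b - (a == b)%:R| <= e.
    by have /negP := nb a b; rewrite -ltNge => /ltW.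
  have nbl' l a b : `|N_ n (f l) w a b - mean_form K (s n) (f l) a *+ (a == b)| <= e.
    by have /negP := nbl l a b; rewrite -ltNge => /ltW.
  have NT : (N_ n f0 w)^T = N_ n f0 w by exact: Mhat_f0_sym.
  have Npd : posdef (N_ n f0 w) by exact: posdef_near1 (ltW e0) ep NT nb'.
  have Nu : N_ n f0 w \in unitmx.
    have [? _ /(_ _ Npd)[G hG _]] := @posdef_whitening_near R p 1 ltr01.
    exact: feasible_unit hG.
  have Mu : M_ n f0 w \in unitmx.
    by rewrite MN !unitmx_mul Omega_inv Nu unitmx_tr.
  have [_ /(_ w Mu)[aG minG]] := HGam n.
  have aG' : argmax_set (N_ n f0 w) (fun l => N_ n (f l) w) (Gam n w *m Omega).
    apply/(argmax_congr _ _ _ Omega_inv); rewrite -MN.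
    rewrite (_ : (fun l => Omega *m N_ n (f l) w *m Omega^T) = fun l => M_ n (f l) w)//.
    by apply/funext => l; rewrite MN.
  have sep a b : a != b -> exists l,
      delta <= `|mean_form K (s n) (f l) a - mean_form K (s n) (f l) b|.
    move=> ab; have [l /= hl] := identif n n0n a b ab; exists l.
    move: hl; rewrite (expect_Mhat_observed Z_indep Z_gauss Z_mean Z_cov).
    rewrite !mulmxA mulVmx// mul1mx -mulmxA mulmxV ?unitmx_tr// mulmx1.
    by rewrite !mxE !eqxx !mulr1n.
  have [G aG2 nearG] := near_id _ _ (fun l => mean_form K (s n) (f l)) NT
    (fun a b => le_trans (nb' a b) ee') (fun l a b => le_trans (nbl' l a b) ee')
    (fun l a => mean_form_le (kap_sum n) (fun r i j => K_kap n r i j) (f_kap n l) a) sep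
    _ aG'.
  pose G2 := G *m invmx Omega.
  have aG2' : argmax_set (M_ n f0 w) (fun l => M_ n (f l) w) G2.
    rewrite MN (_ : (fun l => M_ n (f l) w) = fun l => Omega *m N_ n (f l) w *m Omega^T).
      by apply/(argmax_congr _ _ _ Omega_inv); rewrite /G2 mulmxKV.
    by apply/funext => l; rewrite MN.
  (* [G2] is a maximizer, so the chosen one is at least as close. *)
  apply: (@le_trans _ _ (enorm (G2 - invmx Omega))).
    rewrite /enorm ler_wsqrtr//; have := minG _ aG2'.
    by congr (_ <= _); apply: eq_bigr => a _; apply: eq_bigr => b _; rewrite !mxE.
  apply: le_trans (enorm_le_sum _) _.
  have -> : G2 - invmx Omega = (G - 1%:M) *m invmx Omega by rewrite mulmxBl mul1mx.
  apply: (@le_trans _ _ (\sum_(i < p) eta * B)).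
    apply: ler_sum => i _; rewrite /B exchange_big mulr_sumr/=; apply: ler_sum => b _.
    rewrite mxE mulr_sumr; apply: le_trans (ler_norm_sum _ _ _) _.
    apply: ler_sum => a _; rewrite normrM ler_wpM2r//.
    by have := nearG i a; rewrite !mxE.
  rewrite sumr_const card_ord -[leLHS]mulr_natr /eta -mulrA mulrAC ler_pdivrMr//.
  by rewrite ler_wpM2l ?(ltW eps0)//; lra.
(* The index [None] stands for [f0]. *)
pose I := (option 'I_k * ('I_p * 'I_p))%type.
pose F n (i : I) : set T :=
  if i.1 is Some l then badl n l i.2.1 i.2.2 else bad n i.2.1 i.2.2.
have mge (h : T -> R) : measurable_fun setT h -> measurable [set w | (e <= h w)%R].
  move=> mh; rewrite (_ : [set w | _] = h @^-1` `[e, +oo[%classic).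
    by rewrite -[X in measurable X]setTI; apply: mh => //; exact: measurable_itv.
  by apply/seteqP; split => w /=; rewrite in_itv/= andbT.
have mF n i : measurable (F n i).
  case: i => -[l|] [a b] /=; apply: mge; apply: measurableT_comp => //;
    by apply: measurable_funB => //; exact: random_Mhat_latent.
pose S_ n : set T := [set w | eps < enorm (Gam n w - invmx Omega)].
have mS n : measurable (S_ n).
  have [mG _] := HGam n; have mh := measurable_enorm (invmx Omega) mG.
  rewrite (_ : S_ n = (fun w => enorm (Gam n w - invmx Omega)) @^-1` `]eps, +oo[%classic).
    by rewrite -[X in measurable X]setTI; apply: mh => //; exact: measurable_itv.
  by apply/seteqP; split => w /=; rewrite in_itv/= andbT.
have PS n : (n0 <= n)%N -> (0 < n)%N -> (P (S_ n) <= (#|{: I}|%:R * bound n)%:E)%E.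
  move=> n0n n_gt0; apply: (union_bound (A := F n)) => //.
    move=> w Sw; apply: contrapT => nF; move: Sw; rewrite /S_/= ltNge => /negP; apply.
    apply: good => // [a b|l a b] h; apply: nF.
      by exists (None, (a, b)).
    by exists (Some l, (a, b)).
  by case=> -[l|] [a b]; [exact: Pbadl|exact: Pbad].
apply: (@squeeze_cvge _ _ _ _ (cst 0%E) _ (fun n => (#|{: I}|%:R * bound n)%:E)).
- near=> n; rewrite measure_ge0/=; apply: PS.
    by near: n; exact: nbhs_infty_ge.
  by near: n; exact: nbhs_infty_gt.
- exact: cvg_cst.
- rewrite (_ : (fun n => _) =
      EFin \o (fun n => (#|{: I}|%:R * (2 * C ^+ 4) / e ^+ 2) * n%:R^-1)).
    apply: cvg_EFin; first by near=> n.
    rewrite -[X in _ --> X](mulr0 (#|{: I}|%:R * (2 * C ^+ 4) / e ^+ 2)).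
    apply: cvgM; first exact: cvg_cst.
    apply/gtr0_cvgV0; last exact: cvgr_idn.
    by near=> n; rewrite ltr0n; near: n; exact: nbhs_infty_gt.
  by apply/funext => n /=; congr (_%:E); rewrite /bound; ring.
Unshelve. all: by end_near.
Qed.
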